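(* Let $(H,G,\mu)$ be a crossed module, let $P_*(H,G,\mu)=(R_*,F_*,\eta)$ be its cotriple resolution, let $n\ge1$ and $\langle n\rangle=\{0,\dots,n-1\}$. Write $(R,F,\eta)=(R_{n-1},F_{n-1},\eta)$ and, for $i\in\langle n\rangle$, let $(R_i',F_i',\eta_i')$ be the kernel of the $i$th face morphism $(R_{n-1},F_{n-1},\eta)\to(R_{n-2},F_{n-2},\eta)$ (where for $n=1$ the target is $(H,G,\mu)$ and the morphism is the augmentation). Then there is an isomorphism $$H_{n+1}(H,G,\mu)\cong\frac{(\eta(R)\cdot[F,F])\cap\bigcap_{i\in\langle n\rangle}F_i'}{\eta\big(\bigcap_{i\in\langle n\rangle}R_i'\big)\cdot\prod_{I\subseteq\langle n\rangle}\big[\bigcap_{i\in I}F_i',\bigcap_{i\notin I}F_i'\big]}.$$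
   Context: A crossed module $(H,G,\mu)$ is a group homomorphism $\mu\colon H\to G$ with an action of $G$ on $H$ by automorphisms such that $\mu({}^gh)=g\mu(h)g^{-1}$ and ${}^{\mu(h)}h'=hh'h^{-1}$. A morphism $(\rho,\tau)\colon(H,G,\mu)\to(H',G',\mu')$ is a pair of homomorphisms $\rho\colon H\to H'$, $\tau\colon G\to G'$ with $\tau\mu=\mu'\rho$ and $\rho({}^gh)={}^{\tau(g)}\rho(h)$; $\mathsf{XMod}$ is the resulting category. The kernel of a morphism is $(\ker\rho,\ker\tau)$ with restricted structure. An empty intersection $\bigcap_{i\in\emptyset}F_i'$ is $F$. $[X,Y]$ is the subgroup generated by commutators. Nerve: $\mathrm{Ner}_*(H,G,\mu)$ is the simplicial group with $\mathrm{Ner}_n=H\rtimes(\cdots(H\rtimes G)\cdots)$ ($n$ copies of $H$, the outermost $H$ being acted on by $(h_2,\dots,h_n,g)\in \mathrm{Ner}_{n-1}$ through $\mu(h_2\cdots h_n)g\in G$), faces $d_0(h_1,\dots,h_n,g)=(h_2,\dots,h_n,g)$, $d_i(h_1,\dots,h_n,g)=(h_1,\dots,h_ih_{i+1},\dots,h_n,g)$ for $0<i<n$, $d_n(h_1,\dots,h_n,g)=(h_1,\dots,h_{n-1},\mu(h_n)g)$, and degeneracies $s_i$ inserting $1$ after $h_i$. Integral homology: for a group $G$, $B_*(G)$ is the bar resolution, $B_m(G)=\mathbb{Z}(G)^{\otimes(m+1)}$, $m\ge0$. $H_n(H,G,\mu)$ is the $n$th homology of the total complex of the bicomplex with entries $B_m(\mathrm{Ner}_n(H,G,\mu))\otimes_{\mathrm{Ner}_n(H,G,\mu)}\mathbb{Z}$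 (trivial action on $\mathbb Z$), with vertical differential that of the bar resolution and horizontal differential the alternating sum of the maps induced by the faces of the nerve. Cotriple resolution: the forgetful functor $U\colon\mathsf{XMod}\to\mathsf{Set}$ sends $(H,G,\mu)$ to the underlying set of $H\times G$. Its left adjoint $\mathbf{F}$ sends a set $X$ to the inclusion crossed module $\overline{F_X}\hookrightarrow F_X+F_X$ (with conjugation action), where $F_X$ is the free group on $X$, $F_X+F_X$ is the free product, and $\overline{F_X}$ is the kernel of the homomorphism $F_X+F_X\to F_X$ which is trivial on the first copy and the identity on the second. Let $P=\mathbf{F}U$ be the induced comonad with counit $\epsilon$ and comultiplication $\delta$. The cotriple resolution $P_*(H,G,\mu)\to(H,G,\mu)$ is the augmented simplicial object with $P_k(H,G,\mu)=P^{k+1}(H,G,\mu)$, $d_i^k=P^i(\epsilon(P^{k-i}(H,G,\mu)))$, $s_i^k=P^i(\delta(P^{k-i}(H,G,\mu)))$, $0\le i\le k$; one writes $P_k(H,G,\mu)=(R_k,F_k,\eta)$. *)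

(* Defs.v *)
From HB Require Import structures.
From mathcomp Require Import all_boot ssralg ssrint ring_quotient.
From mathcomp Require Import boolp classical_sets.
From mathcomp Require Import freeg zify.

Set Implicit Arguments.
Unset Strict Implicit.
Unset Printing Implicit Defensive.

Local Open Scope classical_set_scope.

Section Groups.
Local Open Scope group_scope.

Inductive gen (G : groupType) (A : set G) : set G :=
| gen_in x : A x -> gen A x
| gen_1 : gen A 1
| gen_M x y : gen A x -> gen A y -> gen A (x * y)
| gen_V x : gen A x -> gen A x^-1.

Definition set_mul (G : groupType) (A B : set G) : set G :=
  [set x * y | x in A & y in B].

Definition commutator_subgroup (G : groupType) (A B : set G) : set G :=
  gen [set [~ x, y] | x in A & y in B].

Definition subgroup (G : groupType) (A : set G) : Prop :=
  [/\ A 1, forall x y, A x -> A y -> A (x * y) & forall x, A x -> A x^-1].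

Definition normal (G : groupType) (A : set G) : Prop :=
  subgroup A /\ forall x y, A x -> A (x ^ y).

Lemma gen_subgroup (G : groupType) (A : set G) : subgroup (gen A).
Proof. by split; [exact: gen_1|exact: gen_M|exact: gen_V]. Qed.

Lemma gen_sub (G : groupType) (A B : set G) :
  subgroup B -> A `<=` B -> gen A `<=` B.
Proof.
by case=> B1 BM BV AB x; elim=> [y /AB//|//|y z _ By _ Bz|y _ By]; auto.
Qed.

Lemma commutator_normal (G : groupType) (A B : set G) :
  normal A -> normal B -> normal (commutator_subgroup A B).
Proof.
move=> [_ nA] [_ nB]; split; first exact: gen_subgroup.
move=> x y; elim=> [_ [a Aa [b Bb <-]]||u v _ Hu _ Hv|u _ Hu].
- by apply: gen_in; exists (a ^ y); [exact: nA|exists (b ^ y); [exact: nB|rewrite conjRg]].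
- by rewrite conj1g; exact: gen_1.
- by rewrite conjMg; exact: gen_M.
- by rewrite conjVg; exact: gen_V.
Qed.

Lemma commutator_subl (G : groupType) (A B : set G) :
  normal A -> commutator_subgroup A B `<=` A.
Proof.
move=> [sA nA]; apply: gen_sub => // _ [a Aa [b Bb <-]].
by case: (sA) => _ AM AV; apply: AM; [exact: AV|exact: nA].
Qed.

Lemma commutator_subr (G : groupType) (A B : set G) :
  normal B -> commutator_subgroup A B `<=` B.
Proof.
move=> [sB nB]; apply: gen_sub => // _ [a Aa [b Bb <-]].
case: (sB) => _ BM BV; rewrite /commg /conjg mulgA mulgA.
apply: (BM) => //.
suff -> : (a^-1 * b^-1 * a) = (b^-1) ^ a by apply: nB; exact: BV.
by rewrite /conjg mulgA.
Qed.

Lemma set1_normal (G : groupType) : normal [set (1 : G)].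
Proof.
split; first by split=> [//|x y /= -> ->|x /= ->]; rewrite ?mulg1 ?invg1.
by move=> x y /= ->; rewrite conj1g.
Qed.

Lemma setT_normal (G : groupType) : normal [set: G].
Proof. by []. Qed.

Lemma set_mul_normal (G : groupType) (A B : set G) :
  normal A -> normal B -> normal (set_mul A B).
Proof.
move=> [[A1 AM AV] nA] [[B1 BM BV] nB]; split; first split.
- by exists 1 => //; exists 1 => //; rewrite mulg1.
- move=> _ _ [a Aa [b Bb <-]] [a' Aa' [b' Bb' <-]].
  exists (a * a' ^ b^-1); first by apply: AM => //; exact: nA.
  exists (b * b'); first exact: BM.
  by rewrite /conjg invgK !mulgA mulgVK.
- move=> _ [a Aa [b Bb <-]].
  exists (a^-1 ^ b); first by apply: nA; exact: AV.
  exists b^-1; first exact: BV.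
  by rewrite invgM /conjg !mulgA mulgK.
- move=> _ y [a Aa [b Bb <-]].
  exists (a ^ y); first exact: nA.
  by exists (b ^ y); [exact: nB|rewrite conjMg].
Qed.

Lemma set_mul_sub (G : groupType) (A B C : set G) :
  subgroup C -> A `<=` C -> B `<=` C -> set_mul A B `<=` C.
Proof. by move=> [_ CM _] AC BC _ [a /AC Ca [b /BC Cb <-]]; exact: CM. Qed.

Lemma setI_normal (G : groupType) (A B : set G) :
  normal A -> normal B -> normal (A `&` B).
Proof.
move=> [[A1 AM AV] nA] [[B1 BM BV] nB]; split; first split.
- by [].
- by move=> x y [? ?] [? ?]; split; auto.
- by move=> x [? ?]; split; auto.
- by move=> x y [? ?]; split; auto.
Qed.

Lemma bigcap_normal (G : groupType) (T : Type) (P : set T) (A : T -> set G) :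
  (forall i, normal (A i)) -> normal (\bigcap_(i in P) A i).
Proof.
move=> nA; split; first split.
- by move=> i _; case: (nA i) => -[].
- by move=> x y Ax Ay i Pi; case: (nA i) => -[_ AM _] _; apply: AM; auto.
- by move=> x Ax i Pi; case: (nA i) => -[_ _ AV] _; apply: AV; auto.
- by move=> x y Ax i Pi; case: (nA i) => _; apply; auto.
Qed.

Lemma big_set_mul_normal (G : groupType) (T : finType) (A : T -> set G) :
  (forall i, normal (A i)) -> normal (\big[@set_mul G/[set 1]]_i A i).
Proof.
move=> nA; elim/big_ind: _ => //; first exact: set1_normal.
exact: set_mul_normal.
Qed.

Lemma big_set_mul_sub (G : groupType) (T : finType) (A : T -> set G) (C : set G) :
  subgroup C -> (forall i, A i `<=` C) ->
  \big[@set_mul G/[set 1]]_i A i `<=` C.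
Proof.
move=> sC AC; elim/big_ind: _ => //; first by case: sC => C1 _ _ _ ->.
by move=> B B'; exact: set_mul_sub.
Qed.

Record normalPred (G : groupType) := NormalPred {
  npred :> {pred G};
  npred1 : 1 \in npred;
  npredM : forall x y, x \in npred -> y \in npred -> x * y \in npred;
  npredV : forall x, x \in npred -> x^-1 \in npred;
  npredJ : forall x y, x \in npred -> x ^ y \in npred }.

Section QuotientGroup.
Local Open Scope quotient_scope.
Variables (G : groupType) (N : normalPred G).

Definition gequiv (x y : G) := x^-1 * y \in npred N.

Lemma gequiv_is_equiv : equiv_class_of gequiv.
Proof.
split=> [x|x y|y x z]; rewrite /gequiv.
- by rewrite mulVg npred1.
- by apply/idP/idP=> /npredV; rewrite invgM invgK.
- by move=> /npredM h /h; rewrite mulgA mulgK.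
Qed.

Canonical gequiv_equiv := EquivRelPack gequiv_is_equiv.
Canonical gequiv_encModRel := defaultEncModRel gequiv.

Definition quotg := {eq_quot gequiv}.

HB.instance Definition _ : EqQuotient G gequiv quotg := EqQuotient.on quotg.
HB.instance Definition _ := Choice.on quotg.

Definition quotg_one : quotg := \pi_quotg 1.
Definition quotg_mul (x y : quotg) : quotg := \pi_quotg (repr x * repr y).
Definition quotg_inv (x : quotg) : quotg := \pi_quotg (repr x)^-1.

Lemma quotg_piP (x y : G) : \pi_quotg x = \pi_quotg y <-> x^-1 * y \in npred N.
Proof. by split=> [/eqP|h]; [|apply/eqP]; rewrite eqmodE. Qed.

Lemma quotg_reprP (x : G) : x^-1 * repr (\pi_quotg x) \in npred N.
Proof. by apply/quotg_piP; rewrite reprK. Qed.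

Lemma quotg_piM x y : \pi_quotg (x * y) = quotg_mul (\pi x) (\pi y).
Proof.
rewrite /quotg_mul; apply/quotg_piP; set x' := repr _; set y' := repr _.
have -> : (x * y)^-1 * (x' * y') = ((x^-1 * x') ^ y) * (y^-1 * y').
  by rewrite invgM /conjg !mulgA mulgK.
by apply: npredM; [apply: npredJ|]; exact: quotg_reprP.
Qed.

Lemma quotg_piV x : \pi_quotg x^-1 = quotg_inv (\pi x).
Proof.
rewrite /quotg_inv; apply/quotg_piP; set x' := repr _.
have -> : x^-1^-1 * x'^-1 = ((x^-1 * x')^-1) ^ x^-1.
  by rewrite /conjg !(invgM, invgK) !mulgA mulgK.
by apply: npredJ; apply: npredV; exact: quotg_reprP.
Qed.

Lemma quotg_mulA : associative quotg_mul.
Proof.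
elim/quotW=> x; elim/quotW=> y; elim/quotW=> z.
by rewrite -(quotg_piM y z) -(quotg_piM x y) -(quotg_piM x) -(quotg_piM _ z) mulgA.
Qed.

Lemma quotg_mul1 : left_id quotg_one quotg_mul.
Proof. by elim/quotW=> x; rewrite -(quotg_piM 1) mul1g. Qed.

Lemma quotg_mulr1 : right_id quotg_one quotg_mul.
Proof. by elim/quotW=> x; rewrite -(quotg_piM x 1) mulg1. Qed.

Lemma quotg_mulV : left_inverse quotg_one quotg_inv quotg_mul.
Proof. by elim/quotW=> x; rewrite -(quotg_piV x) -(quotg_piM _ x) mulVg. Qed.

Lemma quotg_mulrV : right_inverse quotg_one quotg_inv quotg_mul.
Proof. by elim/quotW=> x; rewrite -(quotg_piV x) -(quotg_piM x) mulgV. Qed.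

HB.instance Definition _ := isGroup.Build quotg
  quotg_mulA quotg_mul1 quotg_mulr1 quotg_mulV quotg_mulrV.

End QuotientGroup.

Section SubgroupType.
Variables (G : groupType) (A : set G).

Definition subgroup_type (_ : subgroup A) := {x : G | `[< A x >]}.

Variable sA : subgroup A.

HB.instance Definition _ := SubChoice.on (subgroup_type sA).

Lemma subgroup_type_closed : group_closed (fun x => `[< A x >]).
Proof.
case: sA => A1 AM AV; split; first exact/asboolP.
by move=> x y /asboolP Ax /asboolP Ay; apply/asboolP; apply: AM => //; exact: AV.
Qed.

HB.instance Definition _ :=
  SubChoice_isSubGroup.Build G _ (subgroup_type sA) subgroup_type_closed.

End SubgroupType.

Section SubQuotient.
Variables (G : groupType) (A B : set G) (sA : subgroup A) (nB : normal B).

Definition subquot_pred : {pred subgroup_type sA} := fun x => `[< B (val x) >].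

Let sq1 : 1 \in subquot_pred.
Proof. by case: nB => -[B1 _ _] _; apply/asboolP; rewrite gmulf1. Qed.

Let sqM x y : x \in subquot_pred -> y \in subquot_pred -> x * y \in subquot_pred.
Proof.
case: nB => -[_ BM _] _ /asboolP Bx /asboolP By.
by apply/asboolP; rewrite gmulfM; exact: BM.
Qed.

Let sqV x : x \in subquot_pred -> x^-1 \in subquot_pred.
Proof.
by case: nB => -[_ _ BV] _ /asboolP Bx; apply/asboolP; rewrite gmulfV; exact: BV.
Qed.

Let sqJ x y : x \in subquot_pred -> x ^ y \in subquot_pred.
Proof.
case: nB => _ BJ /asboolP Bx; apply/asboolP.
by rewrite gmulfJ; exact: BJ.
Qed.

(* [A / (A `&` B)]; used only when [B `<=` A]. *)
Definition subquot := quotg (NormalPred sq1 sqM sqV sqJ).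

HB.instance Definition _ := Group.on subquot.

End SubQuotient.

End Groups.

Notation "'{' 'ghom' G '->' H '}'" :=
  (UMagmaMorphism.type G%type H%type) (at level 0, G at level 98, H at level 99)
  : type_scope.

Section CrossedModules.
Local Open Scope group_scope.

Record gaction (G H : groupType) := GAction {
  gact :> G -> H -> H;
  gact1 : forall h, gact 1 h = h;
  gactM : forall g g' h, gact (g * g') h = gact g (gact g' h);
  gactMr : forall g, {morph gact g : h h' / h * h'} }.

Record xmod := XMod {
  xH : groupType;
  xG : groupType;
  xmu : {ghom xH -> xG};
  xact : gaction xG xH;
  xmuJ : forall g h, xmu (xact g h) = g * xmu h * g^-1;
  xpeiffer : forall h h', xact (xmu h) h' = h * h' * h^-1 }.

Record xmod_hom (X Y : xmod) := XModHom {
  rho : {ghom xH X -> xH Y};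
  tau : {ghom xG X -> xG Y};
  tau_mu : forall h, tau (xmu X h) = xmu Y (rho h);
  rho_act : forall g h, rho (xact X g h) = xact Y (tau g) (rho h) }.

Lemma gactr1 (G H : groupType) (a : gaction G H) g : a g 1 = 1.
Proof.
by apply: (mulgI (a g 1)); rewrite -gactMr !mulg1.
Qed.

Lemma gactrV (G H : groupType) (a : gaction G H) g h : a g h^-1 = (a g h)^-1.
Proof. by apply: (mulgI (a g h)); rewrite -gactMr !mulgV gactr1. Qed.

Lemma gactK (G H : groupType) (a : gaction G H) g : cancel (a g) (a g^-1).
Proof. by move=> h; rewrite -gactM mulVg gact1. Qed.

Lemma gactVK (G H : groupType) (a : gaction G H) g : cancel (a g^-1) (a g).
Proof. by move=> h; rewrite -gactM mulgV gact1. Qed.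

Section PullAction.
Variables (K G H : groupType) (t : {ghom K -> G}) (a : gaction G H).

Let pull1 h : a (t 1) h = h. Proof. by rewrite gmulf1 gact1. Qed.
Let pullM g g' h : a (t (g * g')) h = a (t g) (a (t g') h).
Proof. by rewrite gmulfM gactM. Qed.
Let pullMr g : {morph a (t g) : h h' / h * h'}. Proof. exact: gactMr. Qed.

Definition pull_action : gaction K H := GAction pull1 pullM pullMr.
End PullAction.

Record sdp (G H : groupType) (a : gaction G H) := Sdp { sdl : H; sdr : G }.

Section Semidirect.
Variables (G H : groupType) (a : gaction G H).

Let to_pair (x : sdp a) : H * G := (sdl x, sdr x).
Let of_pair (x : H * G) : sdp a := Sdp a x.1 x.2.
Let to_pairK : cancel to_pair of_pair. Proof. by case. Qed.

HB.instance Definition _ := Choice.copy (sdp a) (can_type to_pairK).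

Definition sdp_one : sdp a := Sdp a 1 1.
Definition sdp_mul (x y : sdp a) : sdp a :=
  Sdp a (sdl x * a (sdr x) (sdl y)) (sdr x * sdr y).
Definition sdp_inv (x : sdp a) : sdp a :=
  Sdp a (a (sdr x)^-1 (sdl x)^-1) (sdr x)^-1.

Let sdpA : associative sdp_mul.
Proof.
by move=> [h g] [h' g'] [h'' g'']; rewrite /sdp_mul /= gactMr gactM !mulgA.
Qed.
Let sdp1 : left_id sdp_one sdp_mul.
Proof. by move=> [h g]; rewrite /sdp_mul /= gact1 !mul1g. Qed.
Let sdpr1 : right_id sdp_one sdp_mul.
Proof. by move=> [h g]; rewrite /sdp_mul /= gactr1 !mulg1. Qed.
Let sdpV : left_inverse sdp_one sdp_inv sdp_mul.
Proof. by move=> [h g]; rewrite /sdp_mul /= -gactMr !mulVg gactr1. Qed.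
Let sdprV : right_inverse sdp_one sdp_inv sdp_mul.
Proof. by move=> [h g]; rewrite /sdp_mul /= gactVK !mulgV. Qed.

HB.instance Definition _ := isGroup.Build (sdp a) sdpA sdp1 sdpr1 sdpV sdprV.

Lemma sdr_monoid_morphism : monoid_morphism (@sdr G H a).
Proof. by []. Qed.
HB.instance Definition _ :=
  isUMagmaMorphism.Build (sdp a) G (@sdr G H a) sdr_monoid_morphism.

End Semidirect.

(* [(h, g) |-> mu h * g], defined on [H ><| K] for any [t : K -> G]. *)
Section ToBase.
Variables (X : xmod) (K : groupType) (t : {ghom K -> xG X}).

Definition to_base (x : sdp (pull_action t (xact X))) : xG X :=
  xmu X (sdl x) * t (sdr x).

Lemma to_base_monoid_morphism : monoid_morphism to_base.
Proof.
split=> [|x y]; rewrite /to_base /=; first by rewrite !gmulf1 mulg1.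
by rewrite !gmulfM /= xmuJ !mulgA mulgVK.
Qed.
HB.instance Definition _ :=
  isUMagmaMorphism.Build _ (xG X) to_base to_base_monoid_morphism.
End ToBase.
Arguments to_base {X K} t x.

(* [ner X n] is [Ner_n] together with [(h_1, ..., h_n, g) |-> mu (h_1 ... h_n) g],
   through which the next copy of [H] is acted on. *)
Record over (K : groupType) := Over { ogrp : groupType; omor : {ghom ogrp -> K} }.

Definition ner (X : xmod) (n : nat) : over (xG X) :=
  iter n (fun N => @Over (xG X) (sdp (pull_action (omor N) (xact X))) (to_base (omor N))) (@Over (xG X) (xG X) idfun).

Definition Ner (X : xmod) (n : nat) : groupType := ogrp (ner X n).
Definition ner_to_base (X : xmod) (n : nat) : {ghom Ner X n -> xG X} :=
  omor (ner X n).

(* The face [d_i], meaningful for [i <= n.+1]. *)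
Fixpoint ner_face (X : xmod) (n i : nat) {struct n} : Ner X n.+1 -> Ner X n :=
  match n return Ner X n.+1 -> Ner X n with
  | 0 => fun x => if i is 0 then sdr x else xmu X (sdl x) * sdr x
  | m.+1 => fun x =>
      match i with
      | 0 => sdr x
      | 1 => Sdp _ (sdl x * sdl (sdr x)) (sdr (sdr x))
      | j.+1 => Sdp _ (sdl x) (ner_face j (sdr x))
      end
  end.

Lemma ner_to_base_face X n i x :
  ner_to_base X n (ner_face i.+1 x) = ner_to_base X n.+1 x.
Proof.
elim: n i x => [|n IHn] i x //.
case: i => [|i]; last by rewrite /ner_to_base /= /to_base /= [X in _ * X]IHn.
by rewrite /ner_to_base /= /to_base /= gmulfM /to_base mulgA.
Qed.

Lemma ner_face_monoid_morphism X n i : monoid_morphism (@ner_face X n i).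
Proof.
elim: n i => [|n IHn] [|[|i]] //=.
- exact: (to_base_monoid_morphism idfun).
- exact: (to_base_monoid_morphism idfun).
- split=> [|x y]; first by congr Sdp; rewrite mulg1.
  congr Sdp => //=; rewrite -/(ner X n) /to_base gactM xpeiffer gactMr.
  by rewrite !mulgA mulgVK.
- split=> [|x y]; first by congr Sdp; exact: (IHn i.+1).1.
  rewrite /= (IHn i.+1).2; congr Sdp => /=.
  by rewrite -(ner_to_base_face i).
Qed.

HB.instance Definition _ X n i :=
  isUMagmaMorphism.Build (Ner X n.+1) (Ner X n) (@ner_face X n i)
    (ner_face_monoid_morphism X n i).

End CrossedModules.

Lemma ner_faceK X n i j (x : Ner X n.+2) : i <= j ->
  ner_face i (ner_face j.+1 x) = ner_face j (ner_face i x).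
Proof.
elim: n i j x => [|n IHn] [|[|i]] [|[|j]] // x le_ij /=.
- by rewrite gmulfM mulgA.
- by rewrite gmulfM mulgA.
- by rewrite mulgA.
- by congr Sdp; exact: (IHn i.+1 j.+1).
Qed.

Arguments ner_face : simpl never.

Section Homology.
Import GRing.Theory.
Local Open Scope ring_scope.

Section AltSum.
Variables (A : nat -> zmodType) (d : forall m, nat -> {additive A m.+1 -> A m}).

Definition alt_sum m (x : A m.+1) : A m :=
  \sum_(i < m.+2) d m i x *~ (-1) ^+ i.

Lemma alt_sum_zmod_morphism m : zmod_morphism (@alt_sum m).
Proof.
move=> x y; rewrite /alt_sum -sumrB; apply: eq_bigr => i _.
by rewrite raddfB mulrzBl.
Qed.
HB.instance Definition _ m :=
  GRing.isZmodMorphism.Build (A m.+1) (A m) (@alt_sum m)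
    (@alt_sum_zmod_morphism m).

Lemma alt_sumK m (x : A m.+2) :
  (forall i j, (i <= j)%N -> d m i (d m.+1 j.+1 x) = d m j (d m.+1 i x)) ->
  alt_sum (alt_sum x) = 0.
Proof.
move=> dK.
pose F i j : A m := d m i (d m.+1 j x) *~ (-1) ^+ (i + j).
have -> : alt_sum (alt_sum x) = \sum_(i < m.+2) \sum_(j < m.+3) F i j.
  rewrite /alt_sum; apply: eq_bigr => i _.
  rewrite raddf_sum mulrz_suml; apply: eq_bigr => j _.
  by rewrite raddfMz -mulrzA mulrC -exprD.
have split_row (i : 'I_m.+2) : \sum_(j < m.+3) F i j =
    \sum_(j < m.+2 | (i <= j)%N) F i j.+1 + \sum_(j < m.+2 | (j <= i)%N) F i j.
  rewrite -(big_mkord xpredT (F i)) (big_cat_nat _ (n := i.+1)) //=; last first.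
    by rewrite ltnS ltnW.
  rewrite addrC; congr (_ + _).
    by rewrite big_add1 /= big_geq_mkord.
  by rewrite big_mkord (big_ord_widen _ (F i) (ltn_ord i)).
rewrite (eq_bigr _ (fun i _ => split_row i)) big_split /=.
rewrite [X in _ + X](exchange_big_dep xpredT) //= -big_split /=.
apply: big1 => i _; rewrite -big_split /=.
apply: big1 => j le_ij; rewrite /F dK // addnS addnC exprS.
by rewrite mulN1r mulrNz addNr.
Qed.

End AltSum.

Inductive zgen (V : zmodType) (A : set V) : set V :=
| zgen_in x : A x -> zgen A x
| zgen_0 : zgen A 0
| zgen_B x y : zgen A x -> zgen A y -> zgen A (x - y).

Section QuotientMap.
Local Open Scope quotient_scope.
Variables (V W : zmodType) (I : zmodClosed V) (J : zmodClosed W).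
Variables (f : {additive V -> W}) (fIJ : forall x, x \in I -> f x \in J).

(* The map induced by [f] on quotients, see [quot_mapE]. *)
Definition quot_map (_ : forall x, x \in I -> f x \in J) :
    Quotient.quot I -> Quotient.quot J :=
  fun x => \pi_(Quotient.quot J) (f (repr x)).

Lemma quot_mapE x :
  quot_map fIJ (\pi_(Quotient.quot I) x) = \pi_(Quotient.quot J) (f x).
Proof.
apply/eqP; rewrite -Quotient.idealrBE -raddfB; apply: fIJ.
by rewrite Quotient.idealrBE reprK.
Qed.

Lemma quot_map_zmod_morphism : zmod_morphism (quot_map fIJ).
Proof.
elim/quotW=> x; elim/quotW=> y.
set pV := \pi_(Quotient.quot I); set pW := \pi_(Quotient.quot J).
have pVB : pV (x - y) = pV x - pV y by rewrite /pV raddfB.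
have pWB u v : pW (u - v) = pW u - pW v by rewrite /pW raddfB.
by rewrite -pVB !quot_mapE raddfB -[LHS]/(pW _) pWB.
Qed.
HB.instance Definition _ :=
  GRing.isZmodMorphism.Build _ _ (quot_map fIJ) quot_map_zmod_morphism.
End QuotientMap.

Section FreeAbelian.
Variables (K L : choiceType) (f : K -> L).

Definition freeg_map : {freeg K / int} -> {freeg L / int} :=
  fglift (fun k => << f k >>).

Lemma freeg_map_zmod_morphism : zmod_morphism freeg_map.
Proof. exact: lift_is_additive. Qed.
HB.instance Definition _ :=
  GRing.isZmodMorphism.Build _ _ freeg_map freeg_map_zmod_morphism.

Lemma freeg_mapU c k : freeg_map << c *g k >> = << c *g f k >>.
Proof. by rewrite /freeg_map liftU; apply/eqP/freeg_eqP=> l; rewrite coeffZ !coeffU mul1r. Qed.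
End FreeAbelian.

Section Bar.
Local Open Scope group_scope.
Variable G : groupType.
Implicit Types (m : nat) (g : G).

(* The tuple [(g_0, ..., g_m)] stands for [g_0 [g_1 | ... | g_m]]. *)
Definition bar m := {freeg (m.+1.-tuple G) / int}.
HB.instance Definition _ m := GRing.Lmodule.on (bar m).

(* [(g_0, ..., g_i * g_(i+1), ..., g_(m+1))] for [i <= m],
   and [(g_0, ..., g_m)] for [i = m.+1]. *)
Definition bar_face m i (t : m.+2.-tuple G) : m.+1.-tuple G :=
  [tuple if (j < i)%N then nth 1 t j
         else if j == i :> nat then nth 1 t j * nth 1 t j.+1
         else nth 1 t j.+1 | j < m.+1].

Definition bar_act m g (t : m.+1.-tuple G) : m.+1.-tuple G :=
  [tuple if j == 0 :> nat then g * nth 1 t j else nth 1 t j | j < m.+1].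

Definition bar_d m : bar m.+1 -> bar m :=
  @alt_sum bar (fun m i => freeg_map (@bar_face m i)) m.
HB.instance Definition _ m := GRing.Additive.on (@bar_d m).

Lemma nth_bar_face m i (t : m.+2.-tuple G) j : (j < m.+1)%N ->
  nth 1 (bar_face i t) j =
  if (j < i)%N then nth 1 t j
  else if j == i then nth 1 t j * nth 1 t j.+1 else nth 1 t j.+1.
Proof. by move=> lt_jm; rewrite (nth_mktuple _ _ (Ordinal lt_jm)). Qed.

Lemma nth_bar_act m g (t : m.+1.-tuple G) j : (j < m.+1)%N ->
  nth 1 (bar_act g t) j = if j == 0 then g * nth 1 t j else nth 1 t j.
Proof. by move=> lt_jm; rewrite (nth_mktuple _ _ (Ordinal lt_jm)). Qed.

Lemma eq_bar_tuple m (t u : m.-tuple G) :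
  (forall j, (j < m)%N -> nth 1 t j = nth 1 u j) -> t = u.
Proof. by move=> tu; apply: eq_from_tnth => j; rewrite !(tnth_nth 1) tu. Qed.

Lemma bar_faceK m i j (t : m.+3.-tuple G) : (i <= j)%N ->
  bar_face i (bar_face j.+1 t) = bar_face j (bar_face i t).
Proof.
move=> le_ij; apply: eq_bar_tuple => k lt_km.
have lt_km' : (k < m.+2)%N by exact: ltnW.
rewrite !nth_bar_face // !ltnS !eqSS (leqNgt k j).
case: (ltngtP k i) => ki; case: (ltngtP k j) => kj;
  case: (ltngtP k.+1 i) => ki1 //=; (try by exfalso; lia); by rewrite ?mulgA.
Qed.

Lemma bar_face_act m i g (t : m.+2.-tuple G) :
  bar_face i (bar_act g t) = bar_act g (bar_face i t).
Proof.
apply: eq_bar_tuple => k lt_km; have lt_km' : (k < m.+2)%N by exact: ltnW.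
rewrite !(nth_bar_act, nth_bar_face) //.
case: k lt_km lt_km' => [|k] lt_km lt_km'; rewrite ?nth_bar_act ?nth_bar_face //=.
by case: ltngtP => //= _; rewrite mulgA.
Qed.

Lemma bar_dK m (b : bar m.+2) : bar_d (bar_d b) = 0%R.
Proof.
apply: alt_sumK => i j le_ij.
elim/freeg_ind_dom0: b => [|k t b _ _ IHb]; first by rewrite !raddf0.
by rewrite !raddfD /= IHb !freeg_mapU bar_faceK.
Qed.

(* [bar m] is a left [Z(G)]-module.  Since [G] acts trivially on [Z], the group
   [bar m (x)_G Z] is the group of coinvariants, i.e. [bar m] divided by the
   subgroup generated by the elements [g b - b]. *)
Definition coinv_rel m : {pred bar m} :=
  fun b => `[< zgen [set (freeg_map (bar_act g.1) g.2 - g.2)%R | g in [set: G * bar m]] b >].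

Lemma coinv_rel_closed m : zmod_closed (@coinv_rel m).
Proof.
split; first exact/asboolP/zgen_0.
by move=> x y /asboolP xz /asboolP yz; apply/asboolP/zgen_B.
Qed.
HB.instance Definition _ m :=
  GRing.isZmodClosed.Build (bar m) (@coinv_rel m) (@coinv_rel_closed m).

Definition bar_coinv m : zmodType := Quotient.quot (@coinv_rel m).

End Bar.

Lemma alt_sum_natural (A B : nat -> zmodType)
    (dA : forall m, nat -> {additive A m.+1 -> A m})
    (dB : forall m, nat -> {additive B m.+1 -> B m})
    (phi : forall m, {additive A m -> B m}) m (x : A m.+1) :
  (forall i, phi m (dA m i x) = dB m i (phi m.+1 x)) ->
  phi m (alt_sum dA x) = alt_sum dB (phi m.+1 x).
Proof.
move=> phid; rewrite /alt_sum raddf_sum; apply: eq_bigr => i _.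
by rewrite raddfMz phid.
Qed.

Lemma coinv_rel_equivariant (G K : groupType) (f : G -> K) m m'
    (phi : {additive bar G m -> bar K m'}) :
  (forall g b, phi (freeg_map (bar_act g) b) = freeg_map (bar_act (f g)) (phi b)) ->
  forall b, b \in coinv_rel (G := G) (m := m) -> phi b \in coinv_rel (G := K) (m := m').
Proof.
move=> phi_act b /asboolP; elim=> [_ [[g c] _ <-]||x y _ + _].
- by apply/asboolP/zgen_in; exists (f g, phi c) => //=; rewrite raddfB phi_act.
- by rewrite raddf0 rpred0.
- by move=> Hx Hy; rewrite raddfB rpredB.
Qed.

Section BarMaps.
Local Open Scope quotient_scope.
Variables (G K : groupType) (f : {ghom G -> K}).

Definition bar_map m : bar G m -> bar K m := freeg_map (map_tuple f).
HB.instance Definition _ m := GRing.Additive.on (@bar_map m).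

Lemma bar_map_act m g (b : bar G m) :
  bar_map (freeg_map (bar_act g) b) = freeg_map (bar_act (f g)) (bar_map b).
Proof.
elim/freeg_ind_dom0: b => [|k t b _ _ IHb]; first by rewrite !raddf0.
rewrite !raddfD /= IHb /bar_map !freeg_mapU; congr (<< _ *g _ >> + _).
apply: eq_bar_tuple => j lt_jm; rewrite nth_bar_act //.
rewrite !(nth_map 1%g) ?size_tuple // nth_bar_act //.
by case: ifP => // _; rewrite gmulfM.
Qed.

Lemma bar_map_d m (b : bar G m.+1) : bar_map (bar_d b) = bar_d (bar_map b).
Proof.
apply: (alt_sum_natural (phi := @bar_map)) => i.
elim/freeg_ind_dom0: b => [|k t b _ _ IHb]; first by rewrite !raddf0.
rewrite !raddfD /= IHb /bar_map !freeg_mapU; congr (<< _ *g _ >> + _).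
apply: eq_bar_tuple => j lt_jm; rewrite nth_bar_face //.
rewrite !(nth_map 1%g) ?size_tuple //; last exact: ltnW.
rewrite nth_bar_face //.
by case: ifP => // _; case: ifP => // _; rewrite gmulfM.
Qed.

Definition coinv_map m : bar_coinv G m -> bar_coinv K m :=
  quot_map (coinv_rel_equivariant (@bar_map_act m)).
HB.instance Definition _ m := GRing.Additive.on (@coinv_map m).

Lemma coinv_mapE m (b : bar G m) :
  coinv_map (\pi_(Quotient.quot (@coinv_rel G m)) b) =
  \pi_(Quotient.quot (@coinv_rel K m)) (bar_map b).
Proof. exact: quot_mapE. Qed.

End BarMaps.

Lemma bar_d_act (G : groupType) m g (b : bar G m.+1) :
  bar_d (freeg_map (bar_act g) b) = freeg_map (bar_act g) (bar_d b).
Proof.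
symmetry; apply: (alt_sum_natural (phi := fun m => freeg_map (@bar_act G m g))) => i.
elim/freeg_ind_dom0: b => [|k t b _ _ IHb]; first by rewrite !raddf0.
by rewrite !raddfD /= IHb !freeg_mapU bar_face_act.
Qed.

Definition coinv_d (G : groupType) m : bar_coinv G m.+1 -> bar_coinv G m :=
  quot_map (coinv_rel_equivariant (@bar_d_act G m)).
HB.instance Definition _ G m := GRing.Additive.on (@coinv_d G m).

Lemma coinv_dE (G : groupType) m (b : bar G m.+1) :
  coinv_d (\pi_(Quotient.quot (@coinv_rel G m.+1)) b)%qT =
  (\pi_(Quotient.quot (@coinv_rel G m)) (bar_d b))%qT.
Proof. exact: quot_mapE. Qed.

Record bicomplex := Bicomplex {
  bico :> nat -> nat -> zmodType;
  bico_h : forall p q, {additive bico p.+1 q -> bico p q};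
  bico_v : forall p q, {additive bico p q.+1 -> bico p q};
  bico_hh : forall p q (x : bico p.+2 q), bico_h p q (bico_h p.+1 q x) = 0;
  bico_vv : forall p q (x : bico p q.+2), bico_v p q (bico_v p q.+1 x) = 0;
  bico_hv : forall p q (x : bico p.+1 q.+1),
    bico_h p q (bico_v p.+1 q x) = bico_v p q (bico_h p q.+1 x) }.

Section TotalComplex.
Variable C : bicomplex.

Definition bifamily : Type := forall p q, C p q.
Implicit Types x y : bifamily.

HB.instance Definition _ := gen_eqMixin bifamily.
HB.instance Definition _ := gen_choiceMixin bifamily.

Let addA : associative (fun x y : bifamily => (fun p q => x p q + y p q) : bifamily).
Proof. by move=> x y z; apply/functional_extensionality_dep => p; apply/functional_extensionality_dep => q; rewrite addrA. Qed.
Let addC : commutative (fun x y : bifamily => (fun p q => x p q + y p q) : bifamily).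
Proof. by move=> x y; apply/functional_extensionality_dep => p; apply/functional_extensionality_dep => q; rewrite addrC. Qed.
Let add0 : left_id ((fun p q => 0) : bifamily)
  (fun x y : bifamily => (fun p q => x p q + y p q) : bifamily).
Proof. by move=> x; apply/functional_extensionality_dep => p; apply/functional_extensionality_dep => q; rewrite add0r. Qed.
Let addN : left_inverse ((fun p q => 0) : bifamily) (fun x p q => - x p q)
  (fun x y : bifamily => (fun p q => x p q + y p q) : bifamily).
Proof. by move=> x; apply/functional_extensionality_dep => p; apply/functional_extensionality_dep => q; rewrite addNr. Qed.
HB.instance Definition _ := GRing.isZmodule.Build bifamily addA addC add0 addN.

(* The degree [k] part of the total complex, the direct sum of the [C p q] with
   [p + q = k], is the group of the families supported on [p + q = k]. *)
Definition in_degree (k : nat) x : Prop := forall p q, (p + q)%N != k -> x p q = 0.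

Definition tot_d (x : bifamily) : bifamily := fun p q =>
  bico_h C p q (x p.+1 q) + bico_v C p q (x p q.+1) *~ (-1) ^+ p.

Lemma tot_d_zmod_morphism : zmod_morphism tot_d.
Proof.
move=> x y; apply/functional_extensionality_dep => p; apply/functional_extensionality_dep => q.
rewrite /tot_d [(x - y) _ _]/(x p.+1 q - y p.+1 q).
rewrite [(x - y) _ _]/(x p q.+1 - y p q.+1).
by rewrite !raddfB mulrzBl addrACA -opprD.
Qed.
HB.instance Definition _ :=
  GRing.isZmodMorphism.Build bifamily bifamily tot_d tot_d_zmod_morphism.

Lemma tot_dK x : tot_d (tot_d x) = 0.
Proof.
apply/functional_extensionality_dep => p; apply/functional_extensionality_dep => q.
rewrite /tot_d !raddfD /= bico_hh add0r mulrzDl.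
rewrite !raddfMz bico_vv !mul0rz addr0 bico_hv.
by rewrite exprS mulN1r mulrNz addNr.
Qed.

Lemma tot_d_degree k x : in_degree k.+1 x -> in_degree k (tot_d x).
Proof.
move=> xk p q pq; by rewrite /tot_d !xk ?raddf0 ?mul0rz ?addr0 ?addnS.
Qed.

Definition tot_cycle_pred k : {pred bifamily} :=
  fun x => `[< in_degree k x /\ tot_d x = 0 >].

Lemma tot_cycle_pred_closed k : zmod_closed (tot_cycle_pred k).
Proof.
split; first by apply/asboolP; split=> //; exact: raddf0.
move=> x y /asboolP[xk dx] /asboolP[yk dy]; apply/asboolP; split.
  move=> p q pq; rewrite -[LHS]/(x p q - y p q) xk // yk // subrr //.
by rewrite (raddfB tot_d) /= dx dy subrr.
Qed.

Definition tot_cycle k := {x : bifamily | tot_cycle_pred k x}.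
HB.instance Definition _ k := SubChoice.on (tot_cycle k).
HB.instance Definition _ k :=
  GRing.SubChoice_isSubZmodule.Build bifamily (tot_cycle_pred k) (tot_cycle k)
    (tot_cycle_pred_closed k).

Definition tot_boundary k : {pred tot_cycle k} :=
  fun z => `[< exists2 y, in_degree k.+1 y & tot_d y = val z >].

Lemma tot_boundary_closed k : zmod_closed (@tot_boundary k).
Proof.
split; first by apply/asboolP; exists 0; rewrite ?raddf0.
move=> x y /asboolP[u uk du] /asboolP[v vk dv]; apply/asboolP.
exists (u - v); last by rewrite (raddfB tot_d) /= du dv -raddfB.
by move=> p q pq; rewrite -[LHS]/(u p q - v p q) uk // vk // subrr.
Qed.
HB.instance Definition _ k :=
  GRing.isZmodClosed.Build (tot_cycle k) (@tot_boundary k) (@tot_boundary_closed k).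

Definition tot_homology k : zmodType := Quotient.quot (@tot_boundary k).

End TotalComplex.

Section XmodHomology.
Local Open Scope quotient_scope.
Variable X : xmod.

Definition ner_bar (p q : nat) : zmodType := bar_coinv (Ner X p) q.

Definition ner_bar_h p q : ner_bar p.+1 q -> ner_bar p q :=
  @alt_sum (ner_bar^~ q) (fun n i => coinv_map (@ner_face X n i) (m := q)) p.
HB.instance Definition _ p q := GRing.Additive.on (@ner_bar_h p q).

Definition ner_bar_v p q : ner_bar p q.+1 -> ner_bar p q := @coinv_d (Ner X p) q.
HB.instance Definition _ p q := GRing.Additive.on (@ner_bar_v p q).

Let bar_map_faceK p q i j (b : bar (Ner X p.+2) q) : (i <= j)%N ->
  bar_map (@ner_face X p i) (bar_map (@ner_face X p.+1 j.+1) b) =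
  bar_map (@ner_face X p j) (bar_map (@ner_face X p.+1 i) b).
Proof.
move=> le_ij.
elim/freeg_ind_dom0: b => [|k t b _ _ IHb]; first by rewrite !raddf0.
rewrite !raddfD /= IHb /bar_map !freeg_mapU; congr (<< _ *g _ >> + _).
apply: eq_bar_tuple => l lt_lm; rewrite !(nth_map 1%g) ?size_tuple //.
exact: ner_faceK.
Qed.

Let ner_bar_hh p q (x : ner_bar p.+2 q) : ner_bar_h (ner_bar_h x) = 0.
Proof.
apply: (@alt_sumK (ner_bar^~ q) (fun n i => coinv_map (@ner_face X n i) (m := q)) p)
  => i j le_ij; elim/quotW: x => b.
by rewrite /= !coinv_mapE bar_map_faceK.
Qed.

Let ner_bar_vv p q (x : ner_bar p q.+2) : ner_bar_v (ner_bar_v x) = 0.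
Proof.
by elim/quotW: x => b; rewrite /ner_bar_v !coinv_dE bar_dK raddf0.
Qed.

Let ner_bar_hv p q (x : ner_bar p.+1 q.+1) :
  ner_bar_h (ner_bar_v x) = ner_bar_v (ner_bar_h x).
Proof.
symmetry; apply: (alt_sum_natural (A := ner_bar^~ q.+1) (B := ner_bar^~ q)
  (phi := fun p => @ner_bar_v p q)) => i.
elim/quotW: x => b.
by rewrite /= /ner_bar_v coinv_mapE !coinv_dE coinv_mapE bar_map_d.
Qed.

Definition xmod_bicomplex : bicomplex :=
  @Bicomplex ner_bar ner_bar_h ner_bar_v ner_bar_hh ner_bar_vv ner_bar_hv.

Definition xmod_homology (n : nat) : zmodType := tot_homology xmod_bicomplex n.

End XmodHomology.

End Homology.

Section FreeGroup.
Local Open Scope group_scope.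
Variable X : choiceType.

(* The letter [(b, x)] stands for [x] if [b] is [false] and for [x^-1] if it is
   [true]; a word is reduced if no letter is followed by its inverse. *)
Definition letter_inv (a : bool * X) : bool * X := (~~ a.1, a.2).
Definition reduced_word (w : seq (bool * X)) : bool :=
  sorted (fun a b => b != letter_inv a) w.

Record free_group := FreeGroup {
  free_word :> seq (bool * X); free_wordP : reduced_word free_word }.

HB.instance Definition _ := [isSub for free_word].
HB.instance Definition _ := [Choice of free_group by <:].

Definition free_push (a : bool * X) (w : seq (bool * X)) : seq (bool * X) :=
  if w is b :: w' then if b == letter_inv a then w' else a :: w else [:: a].

Lemma letter_invK : involutive letter_inv.
Proof. by case=> b x; rewrite /letter_inv negbK. Qed.

Lemma free_push_reduced a w : reduced_word w -> reduced_word (free_push a w).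
Proof.
case: w => [|b w] //= red_w; case: ifP => [_|ba]; first exact: path_sorted red_w.
by rewrite /= ba.
Qed.

Lemma foldr_push_reduced u w : reduced_word w -> reduced_word (foldr free_push w u).
Proof. by move=> red_w; elim: u => //= a u; exact: free_push_reduced. Qed.

Lemma free_pushK a w : reduced_word w -> free_push a (free_push (letter_inv a) w) = w.
Proof.
case: w => [|b w] /=; first by rewrite eqxx.
rewrite letter_invK; case: eqP => [-> /=|_ _ /=]; last by rewrite eqxx.
by case: w => [|c w] //= /andP[/negPf ->].
Qed.

Lemma foldr_push_push a u w : reduced_word w ->
  foldr free_push w (free_push a u) = free_push a (foldr free_push w u).
Proof.
move=> red_w; case: u => [|b u] //=; case: eqP => [->|//].
by rewrite free_pushK //; exact: foldr_push_reduced.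
Qed.

Lemma foldr_push_id u : reduced_word u -> foldr free_push [::] u = u.
Proof.
elim: u => //= a u IHu red_u; rewrite IHu; last exact: path_sorted red_u.
by case: u red_u {IHu} => //= b u /andP[/negPf ->].
Qed.

Definition free_one : free_group := @FreeGroup [::] isT.
Definition free_mul (u v : free_group) : free_group :=
  FreeGroup (foldr_push_reduced u (free_wordP v)).

Lemma free_inv_reduced (u : free_group) : reduced_word (rev (map letter_inv u)).
Proof.
case: u => u /= red_u; rewrite /reduced_word rev_sorted sorted_map.
apply: sub_sorted red_u => a b /=; apply: contraNneq => ab.
by rewrite -[b]letter_invK -ab.
Qed.
Definition free_inv (u : free_group) : free_group :=
  FreeGroup (free_inv_reduced u).

Lemma free_mulA : associative free_mul.
Proof.
move=> u v w; apply: val_inj; rewrite /=.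
elim: (val u) => //= a s ->.
by rewrite foldr_push_push //; exact: free_wordP.
Qed.
Lemma free_mul1 : left_id free_one free_mul.
Proof. by move=> u; exact: val_inj. Qed.
Lemma free_mulr1 : right_id free_one free_mul.
Proof. by move=> u; apply: val_inj => /=; rewrite foldr_push_id //; exact: free_wordP. Qed.
Lemma free_mulrV : right_inverse free_one free_inv free_mul.
Proof.
move=> u; apply: val_inj => /=.
elim/last_ind: (free_word u) => //= s a IHs.
by rewrite map_rcons rev_rcons foldr_rcons /= eqxx.
Qed.
Lemma free_invK : involutive free_inv.
Proof.
move=> u; apply: val_inj; rewrite /= map_rev revK -map_comp.
by rewrite (eq_map letter_invK) map_id.
Qed.
Lemma free_mulV : left_inverse free_one free_inv free_mul.
Proof. by move=> u; rewrite -{2}[u]free_invK free_mulrV. Qed.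

HB.instance Definition _ := isGroup.Build free_group
  free_mulA free_mul1 free_mulr1 free_mulV free_mulrV.

Definition free_gen (x : X) : free_group := @FreeGroup [:: (false, x)] isT.

Section Lift.
Variables (G : groupType) (f : X -> G).

Definition letter_eval (a : bool * X) : G := if a.1 then (f a.2)^-1 else f a.2.

Definition free_lift (u : free_group) : G := \prod_(a <- free_word u) letter_eval a.

Lemma letter_eval_inv a : letter_eval (letter_inv a) = (letter_eval a)^-1.
Proof. by case: a => [[] x]; rewrite /letter_eval //= invgK. Qed.

Lemma free_lift_monoid_morphism : monoid_morphism free_lift.
Proof.
split=> [|u v]; rewrite /free_lift /=; first by rewrite big_nil.
elim: (free_word u) => [|a s IHs] /=; first by rewrite big_nil mul1g.
rewrite big_cons -mulgA -IHs; move: (foldr _ _ _) => [|b t] /=.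
  by rewrite big_seq1 big_nil mulg1.
case: eqP => [->|_]; rewrite !big_cons // letter_eval_inv.
by rewrite mulVKg.
Qed.
HB.instance Definition _ :=
  isUMagmaMorphism.Build free_group G free_lift free_lift_monoid_morphism.

Lemma free_lift_gen x : free_lift (free_gen x) = f x.
Proof. by rewrite /free_lift big_seq1. Qed.

Lemma free_lift_uniq (h : {ghom free_group -> G}) :
  (forall x, h (free_gen x) = f x) -> h =1 free_lift.
Proof.
move=> hf [u red_u]; elim: u red_u => [|a u IHu] red_u.
  by rewrite /free_lift big_nil -[RHS](@gmulf1 _ _ h); congr (h _); exact: val_inj.
have red_u' : reduced_word u by exact: path_sorted red_u.
have au : FreeGroup red_u =
    (if a.1 then (free_gen a.2)^-1 else free_gen a.2) * FreeGroup red_u'.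
  apply: val_inj; case: a red_u => [[] x] /= red_u; rewrite /free_push;
  by case: u red_u {IHu red_u'} => //= b u /andP[/negPf ->].
rewrite [in LHS]au gmulfM IHu /free_lift big_cons; congr (_ * _).
by case: a {red_u au} => [[] x] /=; rewrite /letter_eval /= ?gmulfV hf.
Qed.

End Lift.
End FreeGroup.

Section FreeProduct.
Local Open Scope group_scope.
Variable X : choiceType.

(* [F_X + F_X], modelled by the free group on [X + X]; [freeFF_coproduct] states
   that it is the free product. *)
Definition freeFF := free_group (X + X)%type.
HB.instance Definition _ := Group.on freeFF.

Definition freeFF_inl : free_group X -> freeFF := free_lift (fun x => free_gen (inl x)).
HB.instance Definition _ := UMagmaMorphism.on freeFF_inl.
Definition freeFF_inr : free_group X -> freeFF := free_lift (fun x => free_gen (inr x)).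
HB.instance Definition _ := UMagmaMorphism.on freeFF_inr.

Lemma freeFF_coproduct (G : groupType) (f g : {ghom free_group X -> G}) :
  exists h : {ghom freeFF -> G},
    [/\ h \o freeFF_inl =1 f, h \o freeFF_inr =1 g &
      forall h' : {ghom freeFF -> G},
        h' \o freeFF_inl =1 f -> h' \o freeFF_inr =1 g -> h' =1 h].
Proof.
pose s (z : X + X) := match z with inl x => f (free_gen x) | inr x => g (free_gen x) end.
exists (free_lift s); split.
- move=> u /=; rewrite [RHS](free_lift_uniq (f := f \o @free_gen X)) //.
  apply: (free_lift_uniq (f := f \o @free_gen X) (h := free_lift s \o freeFF_inl)) => x.
  by rewrite /= /freeFF_inl !free_lift_gen.
- move=> u /=; rewrite [RHS](free_lift_uniq (f := g \o @free_gen X)) //.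
  apply: (free_lift_uniq (f := g \o @free_gen X) (h := free_lift s \o freeFF_inr)) => x.
  by rewrite /= /freeFF_inr !free_lift_gen.
- move=> h' hl hr; apply: free_lift_uniq => -[] x.
    by rewrite /= -hl /= /freeFF_inl free_lift_gen.
  by rewrite /= -hr /= /freeFF_inr free_lift_gen.
Qed.

(* The homomorphism [F_X + F_X -> F_X] trivial on the first copy and the
   identity on the second. *)
Definition freeFF_proj : freeFF -> free_group X :=
  free_lift (fun z : X + X => match z with inl _ => 1 | inr x => free_gen x end).
HB.instance Definition _ := UMagmaMorphism.on freeFF_proj.

Definition freeFF_ker := {u : freeFF | freeFF_proj u == 1}.
HB.instance Definition _ := SubChoice.on freeFF_ker.

Lemma freeFF_ker_closed : group_closed (fun u => freeFF_proj u == 1).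
Proof.
split; first by apply/eqP; exact: gmulf1.
move=> u v /eqP pu /eqP pv; apply/eqP.
by rewrite gmulfM gmulfV /= pu pv invg1 mulg1.
Qed.
HB.instance Definition _ :=
  SubChoice_isSubGroup.Build freeFF _ freeFF_ker freeFF_ker_closed.

Lemma freeFF_conj_ker (u : freeFF) (k : freeFF_ker) :
  freeFF_proj (u * val k * u^-1) == 1.
Proof. by rewrite !gmulfM gmulfV /= (eqP (valP k)) mulg1 mulgV. Qed.

Definition freeFF_conj (u : freeFF) (k : freeFF_ker) : freeFF_ker :=
  Sub (u * val k * u^-1) (freeFF_conj_ker u k).

Let conj1 k : freeFF_conj 1 k = k.
Proof. by apply: val_inj; rewrite SubK mul1g invg1 mulg1. Qed.
Let conjM u v k : freeFF_conj (u * v) k = freeFF_conj u (freeFF_conj v k).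
Proof. by apply: val_inj; rewrite !SubK invgM !mulgA. Qed.
Let conjMr u : {morph freeFF_conj u : k k' / k * k'}.
Proof. by move=> k k'; apply: val_inj; rewrite !(SubK, gmulfM) !mulgA mulgVK. Qed.

Definition freeFF_action : gaction freeFF freeFF_ker := GAction conj1 conjM conjMr.

Let val_conj u k : val (freeFF_action u k) = u * val k * u^-1.
Proof. by rewrite SubK. Qed.
Let conj_val k k' : freeFF_action (val k) k' = k * k' * k^-1.
Proof. by apply: val_inj; rewrite SubK !gmulfM gmulfV. Qed.

Definition free_xmod : xmod :=
  @XMod freeFF_ker freeFF (val : freeFF_ker -> freeFF) freeFF_action val_conj conj_val.

End FreeProduct.

Definition xmod_set (Y : xmod) : choiceType := (xH Y * xG Y)%type.

Definition xmod_map (Y Z : xmod) (f : xmod_hom Y Z) (x : xmod_set Y) : xmod_set Z :=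
  (rho f x.1, tau f x.2).

Section FreeXmod.
Local Open Scope group_scope.
Variable X : choiceType.

Lemma free_xmod_unit_ker (x : X) :
  freeFF_proj (free_gen (inl x) : freeFF X) == 1.
Proof. by rewrite /freeFF_proj free_lift_gen. Qed.

(* The unit of the adjunction: [x] is sent to its copies in the first and the
   second factor of [F_X + F_X]. *)
Definition free_xmod_unit (x : X) : xmod_set (free_xmod X) :=
  ((Sub (free_gen (inl x) : freeFF X) (free_xmod_unit_ker x) : freeFF_ker X),
   (free_gen (inr x) : freeFF X)).

Section Lift.
Variables (Y : xmod) (f : X -> xmod_set Y).

(* The homomorphism [F_X + F_X -> H ><| G] sending the first copy of [x] to
   [(h, 1)] and the second one to [(1, g)], where [f x = (h, g)].  It maps the
   kernel of [freeFF_proj] to [H]. *)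
Definition free_xmod_sdp : freeFF X -> sdp (xact Y) :=
  free_lift (fun z : X + X =>
    match z with inl x => Sdp _ (f x).1 1 | inr x => Sdp _ 1 (f x).2 end).
HB.instance Definition _ := UMagmaMorphism.on free_xmod_sdp.

Definition free_xmod_rho (k : freeFF_ker X) : xH Y := sdl (free_xmod_sdp (val k)).
Definition free_xmod_tau (u : freeFF X) : xG Y :=
  xmu Y (sdl (free_xmod_sdp u)) * sdr (free_xmod_sdp u).

Lemma free_xmod_sdr (k : freeFF_ker X) : sdr (free_xmod_sdp (val k)) = 1.
Proof.
suff E u : sdr (free_xmod_sdp u) = free_lift (fun x => (f x).2) (freeFF_proj u).
  by rewrite E (eqP (valP k)) gmulf1.
pose s (z : X + X) := if z is inr x then (f x).2 else 1.
transitivity (free_lift s u).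
  apply: (free_lift_uniq (h := @sdr _ _ (xact Y) \o free_xmod_sdp)) => -[] x;
  by rewrite /= /free_xmod_sdp free_lift_gen.
symmetry.
apply: (free_lift_uniq (h := free_lift (fun x => (f x).2) \o @freeFF_proj X)) => -[] x;
  by rewrite /= /freeFF_proj free_lift_gen /= ?gmulf1 ?free_lift_gen.
Qed.

Lemma free_xmod_rho_monoid_morphism : monoid_morphism free_xmod_rho.
Proof.
split=> [|k k']; rewrite /free_xmod_rho; first by rewrite !gmulf1.
by rewrite !gmulfM /= free_xmod_sdr gact1.
Qed.
HB.instance Definition _ :=
  isUMagmaMorphism.Build _ _ free_xmod_rho free_xmod_rho_monoid_morphism.

Lemma free_xmod_tau_monoid_morphism : monoid_morphism free_xmod_tau.
Proof.
split=> [|u v]; rewrite /free_xmod_tau; first by rewrite !gmulf1 mulg1.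
by rewrite !gmulfM /= xmuJ !mulgA mulgVK.
Qed.
HB.instance Definition _ :=
  isUMagmaMorphism.Build _ _ free_xmod_tau free_xmod_tau_monoid_morphism.

Let lift_mu (k : xH (free_xmod X)) :
  free_xmod_tau (xmu (free_xmod X) k) = xmu Y (free_xmod_rho k).
Proof. by rewrite /free_xmod_tau free_xmod_sdr mulg1. Qed.

Let lift_act (u : xG (free_xmod X)) (k : xH (free_xmod X)) :
  free_xmod_rho (xact (free_xmod X) u k) = xact Y (free_xmod_tau u) (free_xmod_rho k).
Proof.
rewrite /free_xmod_rho [xact _ u k]/(freeFF_conj u k) SubK.
rewrite !gmulfM gmulfV /= free_xmod_sdr /free_xmod_tau !(mulg1, gact1).
by rewrite gactVK gactM xpeiffer.
Qed.

(* The morphism of crossed modules corresponding to [f] under the adjunction. *)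
Definition free_xmod_lift : xmod_hom (free_xmod X) Y :=
  @XModHom (free_xmod X) Y free_xmod_rho free_xmod_tau lift_mu lift_act.

Lemma free_xmod_lift_unit x : xmod_map free_xmod_lift (free_xmod_unit x) = f x.
Proof.
rewrite /xmod_map /= /free_xmod_rho /free_xmod_tau SubK /free_xmod_sdp.
by rewrite !free_lift_gen /= gmulf1 mul1g; case: (f x).
Qed.

(* Together with [free_xmod_lift_unit], [free_xmod] is left adjoint to
   [xmod_set]. *)
Lemma free_xmod_lift_uniq (phi : xmod_hom (free_xmod X) Y) :
  (forall x, xmod_map phi (free_xmod_unit x) = f x) ->
  rho phi =1 rho free_xmod_lift /\ tau phi =1 tau free_xmod_lift.
Proof.
move=> phif; split; last first.
  move=> u; pose t (z : X + X) := tau phi (free_gen z : freeFF X).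
  rewrite [LHS](free_lift_uniq (f := t) (h := tau phi)) //; symmetry.
  apply: (free_lift_uniq (f := t) (h := tau free_xmod_lift)) => -[] x.
    rewrite /t /= /free_xmod_tau /free_xmod_sdp free_lift_gen /= mulg1 -phif.
    by rewrite [RHS](tau_mu phi (free_xmod_unit x).1).
  by rewrite /t /= /free_xmod_tau /free_xmod_sdp free_lift_gen /= gmulf1 mul1g -phif.
pose s (u : freeFF X) : freeFF X := freeFF_inr (freeFF_proj u).
have sM u v : s (u * v) = s u * s v by rewrite /s !gmulfM.
have proj_s u : freeFF_proj (s u) = freeFF_proj u.
  rewrite /s; move: (freeFF_proj u) => w.
  rewrite [LHS](free_lift_uniq (f := @free_gen X) (h := @freeFF_proj X \o @freeFF_inr X)).
    by rewrite -(free_lift_uniq (f := @free_gen X) (h := idfun)).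
  by move=> x; rewrite /= /freeFF_inr free_lift_gen /freeFF_proj free_lift_gen.
have c_ker u : freeFF_proj (u * (s u)^-1) == 1.
  by rewrite gmulfM gmulfV /= proj_s mulgV.
pose c u : freeFF_ker X := Sub (u * (s u)^-1) (c_ker u).
have cM u v : c (u * v) = c u * freeFF_conj (s u) (c v).
  by apply: val_inj; rewrite gmulfM !SubK sM invgM !mulgA mulgVK.
pose Psi u : sdp (xact Y) := Sdp _ (rho phi (c u)) (tau phi (s u)).
have Psi_hom : monoid_morphism Psi.
  split=> [|u v].
    have s1 : s 1 = 1 by rewrite /s !gmulf1.
    rewrite /Psi s1 gmulf1; congr Sdp.
    rewrite -[RHS](@gmulf1 _ _ (rho phi)); congr (rho phi _).
    by apply: val_inj; rewrite SubK s1 invg1 mulg1 gmulf1.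
  rewrite /Psi; congr Sdp; last by rewrite sM gmulfM.
  by rewrite cM gmulfM [X in _ * X](rho_act phi).
pose Psi_mor : {ghom freeFF X -> sdp (xact Y)} :=
  HB.pack Psi (isUMagmaMorphism.Build _ _ Psi Psi_hom).
have PsiE : Psi =1 free_xmod_sdp.
  apply: (free_lift_uniq (h := Psi_mor)) => -[] x /=; rewrite /Psi.
    have sx : s (free_gen (inl x)) = 1.
      by rewrite /s /freeFF_proj free_lift_gen gmulf1.
    rewrite sx gmulf1 -phif; congr (Sdp _ (rho phi _) _).
    by apply: val_inj; rewrite !SubK sx invg1 mulg1.
  have sx : s (free_gen (inr x)) = free_gen (inr x).
    by rewrite /s /freeFF_proj free_lift_gen /freeFF_inr free_lift_gen.
  rewrite sx -phif; congr Sdp; rewrite -[RHS](@gmulf1 _ _ (rho phi)).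
  by congr (rho phi _); apply: val_inj; rewrite SubK sx mulgV gmulf1.
move=> k; rewrite /= /free_xmod_rho -PsiE; congr (rho phi _).
by apply: val_inj; rewrite SubK /s (eqP (valP k)) gmulf1 invg1 mulg1.
Qed.

End Lift.
End FreeXmod.

Definition cotriple (X : xmod) : xmod := free_xmod (xmod_set X).

Definition cotriple_map (X Y : xmod) (f : xmod_hom X Y) :
    xmod_hom (cotriple X) (cotriple Y) :=
  free_xmod_lift (fun x => free_xmod_unit (xmod_map f x)).

Definition cotriple_counit (X : xmod) : xmod_hom (cotriple X) X :=
  free_xmod_lift (fun x : xmod_set X => x).

Definition cotriple_iter (k : nat) (X : xmod) : xmod := iter k cotriple X.

(* [P^i (epsilon (P^(k-i) X)) : P^(k.+1) X -> P^k X], meaningful for [i <= k]. *)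
Fixpoint cotriple_face (k i : nat) (X : xmod) :
    xmod_hom (cotriple_iter k.+1 X) (cotriple_iter k X) :=
  match k, i return xmod_hom (cotriple_iter k.+1 X) (cotriple_iter k X) with
  | k'.+1, i'.+1 => cotriple_map (cotriple_face k' i' X)
  | k', _ => cotriple_counit (cotriple_iter k' X)
  end.

Section Hopf.
Local Open Scope group_scope.
Variables (P Q : xmod) (n : nat) (d : 'I_n -> xmod_hom P Q).

Definition kerH (i : 'I_n) : set (xH P) := [set r | rho (d i) r = 1].
Definition kerG (i : 'I_n) : set (xG P) := [set x | tau (d i) x = 1].

Definition capG (I : {set 'I_n}) : set (xG P) := \bigcap_(i in [set` I]) kerG i.

Definition hopf_num : set (xG P) :=
  set_mul (range (xmu P)) (commutator_subgroup setT setT) `&`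
  \bigcap_(i in [set: 'I_n]) kerG i.

Definition hopf_den : set (xG P) :=
  set_mul (xmu P @` \bigcap_(i in [set: 'I_n]) kerH i)
    (\big[@set_mul (xG P)/[set 1]]_(I : {set 'I_n})
       commutator_subgroup (capG I) (capG (~: I))).

Lemma kerG_normal i : normal (kerG i).
Proof.
split; first split; rewrite /kerG /=.
- exact: gmulf1.
- by move=> x y dx dy; rewrite gmulfM dx dy mulg1.
- by move=> x dx; rewrite gmulfV dx invg1.
- by move=> x y dx; rewrite gmulfJ dx conj1g.
Qed.

Lemma capG_normal I : normal (capG I).
Proof. by apply: bigcap_normal => i; exact: kerG_normal. Qed.

Lemma image_mu_normal (A : set (xH P)) :
  subgroup A -> (forall g r, A r -> A (xact P g r)) -> normal (xmu P @` A).
Proof.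
case=> A1 AM AV Aact; split; first split.
- by exists 1 => //; rewrite gmulf1.
- by move=> _ _ [r Ar <-] [s As <-]; exists (r * s); [exact: AM|rewrite gmulfM].
- by move=> _ [r Ar <-]; exists r^-1; [exact: AV|rewrite gmulfV].
- move=> _ g [r Ar <-]; exists (xact P g^-1 r); first exact: Aact.
  by rewrite xmuJ invgK /conjg mulgA.
Qed.

Lemma hopf_num_normal : normal hopf_num.
Proof.
apply: setI_normal; last by apply: bigcap_normal => i; exact: kerG_normal.
apply: set_mul_normal; first exact: image_mu_normal.
by apply: commutator_normal; exact: setT_normal.
Qed.

Lemma hopf_den_normal : normal hopf_den.
Proof.
apply: set_mul_normal.
  apply: image_mu_normal; first split.
  - by move=> i _; exact: gmulf1.
  - by move=> r s dr ds i _; rewrite /kerH /= gmulfM dr // ds // mulg1.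
  - by move=> r dr i _; rewrite /kerH /= gmulfV dr // invg1.
  - by move=> g r dr i _; rewrite /kerH /= rho_act dr // gactr1.
apply: big_set_mul_normal => I.
by apply: commutator_normal; exact: capG_normal.
Qed.

Lemma hopf_den_sub_num : hopf_den `<=` hopf_num.
Proof.
have [sN _] := hopf_num_normal.
have nF : normal (commutator_subgroup [set: xG P] setT).
  by apply: commutator_normal; exact: setT_normal.
apply: set_mul_sub => //.
  move=> _ [r dr <-]; split.
    exists (xmu P r); first by exists r.
    by exists 1; [case: nF => -[]|rewrite mulg1].
  by move=> i _; rewrite /kerG /= tau_mu dr // gmulf1.
apply: big_set_mul_sub => // I x cx; split.
  exists 1; first by exists 1 => //; rewrite gmulf1.
  exists x; last by rewrite mul1g.
  elim: cx => [_ [a _ [b _ <-]]||u v _ ? _ ?|u _ ?].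
  - by apply: gen_in; exists a => //; exists b.
  - exact: gen_1.
  - exact: gen_M.
  - exact: gen_V.
move=> i _; have [iI|iI] := boolP (i \in I).
  by apply: (commutator_subl (capG_normal I) cx).
by apply: (commutator_subr (capG_normal (~: I)) cx); rewrite /= inE.
Qed.

Definition hopf_quotient : groupType := subquot (proj1 hopf_num_normal) hopf_den_normal.

End Hopf.

(* The quotient formed from [P_k X], for [k = n - 1]; the target of the faces is
   [X] itself when [k = 0]. *)
Definition xmod_hopf (X : xmod) (k : nat) : groupType :=
  hopf_quotient (fun i : 'I_k.+1 => cotriple_face k i X).

(* Main.v *)
Require Import Defs.
From HB Require Import structures.
From mathcomp Require Import all_boot ssralg ssrint ring_quotient.
From mathcomp Require Import boolp classical_sets.
From mathcomp Require Import freeg zify.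

(* Write [P_k] for the cotriple resolution and [T(Y)] for the total complex of
   the nerve of [Y].  The unit of the adjunction contracts the augmented
   simplicial group of the [T_m(P_k)] over [T_m(X)], because the bar construction modulo [G] is
   functorial for maps of sets.  On the other hand [T(P_k)] has homology only in
   degrees 0 and 1: the nerve of a free crossed module contracts onto the free
   group [F / R], whose bar complex is contracted by the Fox derivative.  Hence
   the elements of [T_m(P_k)] killed by all faces (all but [d_0]) give short
   exact sequences whose connecting maps lower [m] and raise [k], and they
   identify [H_(n+1)(X)] with the classes of [[x] - [1]] in [T_1(P_(n-1))] for
   [x] in the numerator.
   Such a class vanishes if and only if [x] is [d_0] of an element of
   [R [F, F]] killed by [d_1, ..., d_n] in [P_n].  The degeneracies make these
   faces a split cube, and there an element [x] of the mixed commutator subgroup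
   for a set [S] of faces is congruent to its image under [s d_i] modulo the one
   for [S] and [i]; by induction on [S], the elements of [R [F, F]] killed by
   [d_1, ..., d_n] form the product of [eta (bigcap R_i')] with the mixed
   commutators. *)

Set Implicit Arguments.
Unset Strict Implicit.
Unset Printing Implicit Defensive.

Import GRing.Theory.
Local Open Scope classical_set_scope.
Local Open Scope ring_scope.

(** * Coinvariants of the bar resolution *)

Section FreeAbelianGroups.
Variable K : choiceType.

(** Closure under differences yields negatives, sums and integer multiples, so only basis elements
    remain to be treated. *)
Lemma freeg_zind (P : {freeg K / int} -> Prop) :
  (forall k, P << k >>) -> P 0 -> (forall x y, P x -> P y -> P (x - y)) ->
  forall x, P x.
Proof.
move=> PU P0 PB.
have PN x : P x -> P (- x) by move=> Px; rewrite -sub0r; exact: PB.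
have PD x y : P x -> P y -> P (x + y).
  by move=> Px Py; rewrite -[y]opprK; apply: PB => //; exact: PN.
have PMn x n : P x -> P (x *+ n).
  by move=> Px; elim: n => [|n IHn]; rewrite ?mulr0n // mulrS; exact: PD.
move=> x; rewrite -[x]freeg_sumE; elim/big_ind: _ => // k _.
have -> : << coeff k x *g k >> = << k >> *~ coeff k x :> {freeg K / int}.
  by rewrite freegU_mulz intz.
by case: (coeff k x) => n; [exact: PMn|rewrite NegzE mulrNz; apply: PN; exact: PMn].
Qed.

(** [zmodule V] is [V] with its canonical structure of module over the integers, which [fglift]
    expects of its target. *)
Definition zlift (V : zmodType) (f : K -> V) (x : {freeg K / int}) : V :=
  fglift (f : K -> zmodule V) x.

Lemma zlift_zmod_morphism (V : zmodType) (f : K -> V) : zmod_morphism (zlift f).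
Proof. exact: (lift_is_additive (f : K -> zmodule V)). Qed.
HB.instance Definition _ (V : zmodType) (f : K -> V) :=
  GRing.isZmodMorphism.Build {freeg K / int} V (zlift f) (zlift_zmod_morphism f).

Lemma zliftU (V : zmodType) (f : K -> V) k : zlift f << k >> = f k.
Proof. by rewrite /zlift liftU scale1r. Qed.

End FreeAbelianGroups.

Section Coinvariants.
Local Open Scope quotient_scope.
Variables (G : groupType) (m : nat).

Definition cpi (b : bar G m) : bar_coinv G m := \pi_(Quotient.quot (@coinv_rel G m)) b.

Lemma cpi_zmod_morphism : zmod_morphism cpi.
Proof. by move=> x y; rewrite /cpi raddfB. Qed.
HB.instance Definition _ :=
  GRing.isZmodMorphism.Build (bar G m) (bar_coinv G m) cpi cpi_zmod_morphism.

Lemma cpi_surj (x : bar_coinv G m) : exists b, x = cpi b.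
Proof. by exists (repr x); rewrite /cpi reprK. Qed.

Lemma cpi_eq0 b : (cpi b = 0) <-> b \in coinv_rel (G := G) (m := m).
Proof.
rewrite -[in X in _ <-> X](subr0 b) -[0 in X in _ <-> X]/(0 : bar G m).
rewrite Quotient.idealrBE; split=> [b0|/eqP E]; last by rewrite /cpi E raddf0.
by rewrite -[\pi _]/(cpi b) b0 /cpi raddf0.
Qed.

Definition cls (t : m.+1.-tuple G) : bar_coinv G m := cpi << t >>.

Lemma cls_act g t : cls (bar_act g t) = cls t.
Proof.
apply/eqP; rewrite -subr_eq0 /cls -raddfB; apply/eqP/cpi_eq0/asboolP/zgen_in.
by exists (g, << t >>) => //=; rewrite freeg_mapU.
Qed.

Lemma coinv_ind (P : bar_coinv G m -> Prop) :
  (forall t, P (cls t)) -> P 0 -> (forall x y, P x -> P y -> P (x - y)) ->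
  forall x, P x.
Proof.
move=> Pc P0 PB x; have [b ->] := cpi_surj x.
elim/freeg_zind: b => [k||b c Pb Pc']; [exact: Pc|by rewrite raddf0|].
by rewrite raddfB; exact: PB.
Qed.

Section Lift.
Variables (V : zmodType) (f : m.+1.-tuple G -> V).
Hypothesis f_act : forall g t, f (bar_act g t) = f t.

(** The invariance proof is an argument because the additive structure attached to the term depends
    on it. *)
Definition coinv_lift of (forall g t, f (bar_act g t) = f t) :=
  fun x : bar_coinv G m => zlift f (repr x).

Lemma zlift_coinv b : b \in coinv_rel (G := G) (m := m) -> zlift f b = 0.
Proof.
move=> /asboolP; elim=> [_ [[g c] _ <-]||x y _ + _]; last 2 first.
- by rewrite raddf0.
- by move=> fx fy; rewrite raddfB /= fx fy subr0.
rewrite raddfB /=; apply/eqP; rewrite subr_eq0; apply/eqP.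
elim/freeg_zind: c => [t||x y fx fy]; [|by rewrite !raddf0|].
  by rewrite freeg_mapU !zliftU f_act.
by rewrite !raddfB /= fx fy.
Qed.

Lemma coinv_lift_cpi b : coinv_lift f_act (cpi b) = zlift f b.
Proof.
apply/eqP; rewrite /coinv_lift -subr_eq0 -raddfB; apply/eqP/zlift_coinv.
by rewrite Quotient.idealrBE reprK.
Qed.

Lemma coinv_lift_zmod_morphism : zmod_morphism (coinv_lift f_act).
Proof.
move=> x y; have [b ->] := cpi_surj x; have [c ->] := cpi_surj y.
by rewrite -raddfB !coinv_lift_cpi raddfB.
Qed.
HB.instance Definition _ :=
  GRing.isZmodMorphism.Build (bar_coinv G m) V (coinv_lift f_act)
    coinv_lift_zmod_morphism.

Lemma coinv_liftE t : coinv_lift f_act (cls t) = f t.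
Proof. by rewrite /cls coinv_lift_cpi zliftU. Qed.
End Lift.

End Coinvariants.

Lemma coinv_dcls (G : groupType) m (t : m.+2.-tuple G) :
  coinv_d (cls t) = \sum_(i < m.+2) cls (bar_face i t) *~ (-1) ^+ i.
Proof.
rewrite coinv_dE -[LHS]/(cpi _) /bar_d /alt_sum raddf_sum; apply: eq_bigr => i _.
by rewrite raddfMz /= freeg_mapU.
Qed.

Section SetMaps.
Variables (G K : groupType) (f : G -> K).

Lemma cls_map_act m g (t : m.+1.-tuple G) :
  cls (map_tuple f (bar_act g t)) = cls (map_tuple f t).
Proof.
have -> : map_tuple f (bar_act g t) =
    bar_act (f (g * nth 1 t 0)%g * (f (nth 1 t 0))^-1)%g (map_tuple f t).
  apply: eq_bar_tuple => j lt_jm.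
  rewrite nth_bar_act // !(nth_map 1%g) ?size_tuple // nth_bar_act //.
  by case: j lt_jm => [|j] lt_jm //=; rewrite mulgVK.
exact: cls_act.
Qed.

(* The action on coinvariants only moves the coordinate [g_0], so [bar_coinv] is
   functorial for arbitrary maps and not only for homomorphisms. *)
Definition csmap m : bar_coinv G m -> bar_coinv K m := coinv_lift (@cls_map_act m).
HB.instance Definition _ m := GRing.Additive.on (@csmap m).

Lemma csmapE m (t : m.+1.-tuple G) : csmap (cls t) = cls (map_tuple f t).
Proof. exact: coinv_liftE. Qed.
End SetMaps.

Lemma csmap_comp (G K L : groupType) (f : G -> K) (g : K -> L) m (x : bar_coinv G m) :
  csmap g (csmap f x) = csmap (g \o f) x.
Proof.
elim/coinv_ind: x => [t||x y gx gy]; [|by rewrite !raddf0|by rewrite !raddfB /= gx gy].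
by rewrite !csmapE; congr cls; apply: val_inj; rewrite /= -map_comp.
Qed.

Lemma csmap_id (G : groupType) (f : G -> G) m (x : bar_coinv G m) :
  f =1 id -> csmap f x = x.
Proof.
move=> f1.
elim/coinv_ind: x => [t||x y gx gy]; [|by rewrite !raddf0|by rewrite !raddfB /= gx gy].
by rewrite !csmapE; congr cls; apply: val_inj; rewrite /= (eq_map f1) map_id.
Qed.

Lemma coinv_map_csmap (G K : groupType) (f : {ghom G -> K}) m (x : bar_coinv G m) :
  coinv_map f x = csmap f x.
Proof.
elim/coinv_ind: x => [t||x y gx gy]; [|by rewrite !raddf0|by rewrite !raddfB /= gx gy].
by rewrite csmapE coinv_mapE /bar_map freeg_mapU.
Qed.

Lemma csmap_d (G K : groupType) (f : {ghom G -> K}) m (x : bar_coinv G m.+1) :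
  csmap f (coinv_d x) = coinv_d (csmap f x).
Proof.
rewrite -!coinv_map_csmap; have [b ->] := cpi_surj x.
by rewrite /cpi coinv_mapE !coinv_dE coinv_mapE bar_map_d.
Qed.

(** * Maps of nerves *)

Lemma ner_face0E (Y : xmod) n (x : Ner Y n.+1) : ner_face 0 x = sdr x.
Proof. by case: n x. Qed.

Lemma ner_face01E (Y : xmod) i (x : Ner Y 1) :
  @ner_face Y 0 i.+1 x = (xmu Y (sdl x) * sdr x)%g.
Proof. by []. Qed.

Lemma ner_face1E (Y : xmod) n (x : Ner Y n.+2) :
  @ner_face Y n.+1 1 x = Sdp _ (sdl x * sdl (sdr x))%g (sdr (sdr x)).
Proof. by []. Qed.

Lemma ner_faceSE (Y : xmod) n i (x : Ner Y n.+2) :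
  @ner_face Y n.+1 i.+2 x = Sdp _ (sdl x) (ner_face i.+1 (sdr x)).
Proof. by []. Qed.

Section NerveMaps.
Variables (Y Z : xmod) (a : xH Y -> xH Z) (b : xG Y -> xG Z).

(** [a] and [b] are mere maps of sets, so that the contraction of the resolution also acts on
    chains, through [tmap]. *)
Fixpoint nmap p : Ner Y p -> Ner Z p :=
  match p return Ner Y p -> Ner Z p with
  | 0 => b
  | p'.+1 => fun x => Sdp _ (a (sdl x)) (nmap (sdr x))
  end.
Arguments nmap : clear implicits.

Definition tmap (x : bifamily (xmod_bicomplex Y)) : bifamily (xmod_bicomplex Z) :=
  fun p q => csmap (nmap p) (x p q).

Lemma tmap_zmod_morphism : zmod_morphism tmap.
Proof.
move=> x y; apply/functional_extensionality_dep => p.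
by apply/functional_extensionality_dep => q; exact: (raddfB (csmap (nmap p) (m := q))).
Qed.
HB.instance Definition _ := GRing.isZmodMorphism.Build _ _ tmap tmap_zmod_morphism.

Lemma tmap_degree k x : in_degree k x -> in_degree k (tmap x).
Proof. by move=> xk p q pq; rewrite /tmap xk // raddf0. Qed.
End NerveMaps.
Arguments nmap {Y Z} a b p x.

Lemma bifamily_ext (C : bicomplex) (x y : bifamily C) :
  (forall p q, x p q = y p q) -> x = y.
Proof.
move=> xy; apply/functional_extensionality_dep => p.
by apply/functional_extensionality_dep => q.
Qed.

Lemma nmap_comp (W Y Z : xmod) (a : xH W -> xH Y) (b : xG W -> xG Y)
    (a' : xH Y -> xH Z) (b' : xG Y -> xG Z) p :
  nmap a' b' p \o nmap a b p =1 nmap (a' \o a) (b' \o b) p.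
Proof. by elim: p => [//|p IHp] x /=; congr Sdp; exact: IHp. Qed.

Lemma nmap_ext (Y Z : xmod) (a a' : xH Y -> xH Z) (b b' : xG Y -> xG Z) p :
  a =1 a' -> b =1 b' -> nmap a b p =1 nmap a' b' p.
Proof. by move=> aa bb; elim: p => [//|p IHp] x /=; rewrite aa IHp. Qed.

Lemma nmap_id (Y : xmod) p : @nmap Y Y id id p =1 id.
Proof. by elim: p => [//|p IHp] [h x] /=; rewrite IHp. Qed.

Lemma csmap_ext (G K : groupType) (f g : G -> K) m :
  f =1 g -> csmap f (m := m) =1 csmap g (m := m).
Proof. by move/funext->. Qed.

Lemma tmap_comp (W Y Z : xmod) (a : xH W -> xH Y) (b : xG W -> xG Y)
    (a' : xH Y -> xH Z) (b' : xG Y -> xG Z) x :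
  tmap a' b' (tmap a b x) = tmap (a' \o a) (b' \o b) x.
Proof.
apply: bifamily_ext => p q; rewrite /tmap csmap_comp.
by apply: csmap_ext; exact: nmap_comp.
Qed.

Lemma tmap_ext (Y Z : xmod) (a a' : xH Y -> xH Z) (b b' : xG Y -> xG Z) :
  a =1 a' -> b =1 b' -> tmap a b =1 tmap a' b'.
Proof.
move=> aa bb x; apply: bifamily_ext => p q.
by apply: csmap_ext; exact: nmap_ext.
Qed.

Lemma tmap_id (Y : xmod) x : @tmap Y Y id id x = x.
Proof. by apply: bifamily_ext => p q; apply: csmap_id; exact: nmap_id. Qed.

Section NerveMorphisms.
Variables (Y Z : xmod) (f : xmod_hom Y Z).

Definition ner_map p : Ner Y p -> Ner Z p := nmap (rho f) (tau f) p.

Lemma ner_map_base p x : ner_to_base Z p (ner_map x) = tau f (ner_to_base Y p x).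
Proof.
elim: p x => [//|p IHp] [h x]; rewrite /ner_to_base /= /to_base /=.
by rewrite gmulfM tau_mu; congr (_ * _)%g; exact: IHp.
Qed.

Lemma ner_map_monoid_morphism p : monoid.monoid_morphism (@ner_map p).
Proof.
elim: p => [|p [IH1 IHM]]; first by split=> [|x y]; [exact: gmulf1|exact: gmulfM].
split=> [|[h x] [h' x']]; first by congr Sdp; rewrite ?gmulf1.
congr Sdp; rewrite /= ?IHM // gmulfM rho_act.
by rewrite -[omor (ner Y p) x]/(ner_to_base Y p x) -ner_map_base.
Qed.
HB.instance Definition _ p :=
  isUMagmaMorphism.Build (Ner Y p) (Ner Z p) (@ner_map p) (@ner_map_monoid_morphism p).

Lemma ner_map_face p i x : ner_map (@ner_face Y p i x) = ner_face i (ner_map x).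
Proof.
elim: p i x => [|p IHp] [|[|i]] x.
- by rewrite !ner_face0E.
- by rewrite !ner_face01E /ner_map /= gmulfM tau_mu.
- by rewrite !ner_face01E /ner_map /= gmulfM tau_mu.
- by rewrite !ner_face0E.
- by rewrite !ner_face1E /ner_map /= gmulfM.
- by rewrite !ner_faceSE /ner_map /=; congr Sdp; exact: IHp.
Qed.

Definition thom : bifamily (xmod_bicomplex Y) -> bifamily (xmod_bicomplex Z) :=
  tmap (rho f) (tau f).
HB.instance Definition _ := GRing.Additive.on thom.

Lemma thom_d x : thom (tot_d x) = tot_d (thom x).
Proof.
apply: bifamily_ext => p q; rewrite /thom /tmap /tot_d raddfD raddfMz /=.
congr (_ + _ *~ _); last exact: (csmap_d (@ner_map p)).
apply: (alt_sum_natural (A := fun p => ner_bar Y p q) (B := fun p => ner_bar Z p q)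
  (phi := fun p => csmap (@ner_map p) (m := q))) => i.
rewrite /= !coinv_map_csmap !csmap_comp; apply: csmap_ext => u.
exact: ner_map_face.
Qed.

Lemma thom_degree k x : in_degree k x -> in_degree k (thom x).
Proof. exact: tmap_degree. Qed.
End NerveMorphisms.

(** * Mixed commutators of a split cube *)

Section Commutators.
Local Open Scope group_scope.
Variable G : groupType.
Implicit Types (x y z : G) (A B D : set G).

Lemma commMgJ x y z : [~ x * y, z] = [~ x, z] ^ y * [~ y, z].
Proof. by rewrite /commg /conjg !invgM !mulgA !mulgK. Qed.

Lemma commgMJ x y z : [~ x, y * z] = [~ x, z] * [~ x, y] ^ z.
Proof. by rewrite /commg /conjg !invgM !mulgA !mulgK. Qed.

Lemma set_mul_supl A B : B 1 -> A `<=` set_mul A B.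
Proof. by move=> B1 x Ax; exists x => //; exists 1; rewrite ?mulg1. Qed.

Lemma set_mul_supr A B : A 1 -> B `<=` set_mul A B.
Proof. by move=> A1 x Bx; exists 1 => //; exists x; rewrite ?mul1g. Qed.

Lemma big_set_mul_sup (T : finType) (A : T -> set G) i :
  (forall j, A j 1) -> A i `<=` \big[@set_mul G/[set 1]]_j A j.
Proof.
move=> A1; have B1 (r : seq T) : (\big[@set_mul G/[set 1]]_(j <- r) A j) 1.
  elim: r => [|j r IHr]; first by rewrite big_nil.
  by rewrite big_cons; exists 1 => //; exists 1; rewrite ?mulg1.
have := mem_index_enum i; elim: (index_enum T) => // j r IHr.
rewrite inE big_cons => /orP[/eqP<-|ir]; first exact: set_mul_supl.
by move=> x Ax; apply: set_mul_supr => //; exact: IHr.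
Qed.

(** This is the equalizer of [e] and the identity modulo [D]; it allows the congruence of [x] and
    [e x] to be checked on generators. *)
Lemma normal_congr_subgroup D (e : {ghom G -> G}) :
  normal D -> subgroup [set x | D (x * (e x)^-1)].
Proof.
move=> [[D1 DM DV] DJ]; split=> /= [|x y Dx Dy|x Dx].
- by rewrite gmulf1 mulgV.
- have -> : x * y * (e (x * y))^-1 = (y * (e y)^-1) ^ x^-1 * (x * (e x)^-1).
    by rewrite /conjg invgK gmulfM invgM !mulgA mulgVK.
  by apply: DM => //; exact: DJ.
- have -> : x^-1 * (e x^-1)^-1 = (x * (e x)^-1)^-1 ^ e x.
    by rewrite /conjg gmulfV invgM !invgK !mulgA mulVg mul1g.
  by apply: DJ; exact: DV.
Qed.

End Commutators.

Section Composition.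
Variables X Y Z : xmod.

Definition xmod_comp (g : xmod_hom Y Z) (f : xmod_hom X Y) : xmod_hom X Z.
Proof.
refine (@XModHom X Z (rho g \o rho f) (tau g \o tau f) _ _).
- by move=> h /=; rewrite !tau_mu.
- by move=> k h /=; rewrite !rho_act.
Defined.

Definition xeq (f g : xmod_hom X Y) : Prop := rho f =1 rho g /\ tau f =1 tau g.
End Composition.

Definition xmod_id (X : xmod) : xmod_hom X X :=
  @XModHom X X idfun idfun (fun h => erefl) (fun k h => erefl).

(* As for the faces [d_1, ..., d_n] of a simplicial object, sectioned by the
   degeneracies [s_0, ..., s_(n-1)]: [d_i s = 1], and [s d_i] preserves the
   kernel of [d_j] for [j > i]. *)
Definition split_faces (Y Z : xmod) n (d : 'I_n -> xmod_hom Y Z) : Prop :=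
  forall i, exists s : xmod_hom Z Y, xeq (xmod_comp (d i) s) (xmod_id Z) /\
    forall j : 'I_n, (i < j)%N -> exists g : xmod_hom Z Z,
      xeq (xmod_comp (d j) (xmod_comp s (d i))) (xmod_comp g (d j)).

Section SplitHopf.
Local Open Scope group_scope.
Variables (Y Z : xmod) (n : nat) (d : 'I_n -> xmod_hom Y Z).
Hypothesis split_d : split_faces d.

Let S t : {set 'I_n} := finset (fun j : 'I_n => (t <= j)%N).
Let KH t : set (xH Y) := \bigcap_(i in [set` S t]) kerH d i.
(** The mixed commutator subgroup for the faces of index at least [t]. It interpolates between
    [mu(H) [G, G]] at [t = n] and [hopf_den d] at [t = 0]. *)
Let D t : set (xG Y) :=
  set_mul (xmu Y @` KH t)
    (\big[@set_mul (xG Y)/[set 1]]_(I : {set 'I_n})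
       commutator_subgroup (capG d (I :&: S t)) (capG d (S t :\: I))).

Let D_comm_normal t (I : {set 'I_n}) :
  normal (commutator_subgroup (capG d (I :&: S t)) (capG d (S t :\: I))).
Proof. by apply: commutator_normal; exact: capG_normal. Qed.

Let muKH_normal t : normal (xmu Y @` KH t).
Proof.
apply: image_mu_normal; first split.
- by move=> i _; exact: gmulf1.
- by move=> r s dr ds i Si; rewrite /kerH /= gmulfM dr // ds // mulg1.
- by move=> r dr i Si; rewrite /kerH /= gmulfV dr // invg1.
- by move=> g r dr i Si; rewrite /kerH /= rho_act dr // gactr1.
Qed.

Let D_normal t : normal (D t).
Proof.
by apply: set_mul_normal; [exact: muKH_normal|apply: big_set_mul_normal].
Qed.

Let D_mu t r : KH t r -> D t (xmu Y r).
Proof.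
move=> Kr; apply: set_mul_supl; last by exists r.
by case: (big_set_mul_normal (D_comm_normal t)) => -[].
Qed.

Let D_comm t (I : {set 'I_n}) a b :
  capG d (I :&: S t) a -> capG d (S t :\: I) b -> D t [~ a, b].
Proof.
move=> Ka Kb; apply: set_mul_supr; first by case: (muKH_normal t) => -[].
apply: (@big_set_mul_sup _ _ _ I); first by move=> J; case: (D_comm_normal t J) => -[].
by apply: gen_in; exists a => //; exists b.
Qed.

(** Put [e = s d_i]. Every [x] in [D i.+1] is congruent to [e x] modulo [D i], and [e x = 1] as soon
    as [d_i] kills [x]. *)
Let D_step (i : 'I_n) x : D i.+1 x -> tau (d i) x = 1 -> D i x.
Proof.
move=> Dx dx; have [s [[ds_rho ds_tau] sg]] := split_d i.
have SE : S i = i |: S i.+1.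
  apply/setP=> j; rewrite !inE leq_eqVlt; congr orb.
  by apply/eqP/eqP=> [?|->//]; exact: val_inj.
have iS : i \notin S i.+1 by rewrite inE ltnn.
pose e := xmod_comp s (d i); pose et : {ghom xG Y -> xG Y} := tau e.
have d_e a : tau (d i) (a * (et a)^-1) = 1.
  by rewrite gmulfM gmulfV /et /= [tau (d i) (tau s _)]ds_tau mulgV.
have d_eH r : rho (d i) (r * (rho e r)^-1) = 1.
  by rewrite gmulfM gmulfV /= [rho (d i) (rho s _)]ds_rho mulgV.
have capS (I : {set 'I_n}) : I \subset S i.+1 -> forall a, capG d I a -> capG d I (et a).
  move=> IS a Ka j jI; have [|g [_ gE]] := sg j.
    by have /(fintype.subsetP IS) := jI; rewrite inE.
  by rewrite /kerG /= [LHS]gE /= Ka // gmulf1.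
have capH r : KH i.+1 r -> KH i.+1 (rho e r).
  move=> Kr j jS; have [|g [gE _]] := sg j.
    by move: jS; rewrite /= inE.
  by rewrite /kerH /= [LHS]gE /= Kr // gmulf1.
have capD (I : {set 'I_n}) : I \subset S i.+1 ->
    forall a, capG d I a -> capG d (i |: I) (a * (et a)^-1).
  move=> IS a Ka j /=; rewrite !inE => /orP[/eqP->|jI]; first exact: d_e.
  by rewrite /kerG /= gmulfM gmulfV Ka // [tau _ _](capS I IS a Ka) // mulgV.
have nD := D_normal i; have [[D1 DM DV] DJ] := nD.
suff : D i (x * (et x)^-1) by rewrite /et /= dx gmulf1 invg1 mulg1.
have sE := normal_congr_subgroup et nD.
move: x Dx {dx}; apply: (set_mul_sub sE).
  move=> _ [r Kr <-] /=.
  have -> : xmu Y r * (et (xmu Y r))^-1 = xmu Y (r * (rho e r)^-1).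
    by rewrite gmulfM gmulfV -tau_mu.
  apply: D_mu => j /=; rewrite SE !inE => /orP[/eqP->|jS]; first exact: d_eH.
  have jS' : j \in S i.+1 by rewrite inE.
  by rewrite /kerH /= gmulfM gmulfV Kr // [rho _ _](capH r Kr) // mulgV.
apply: (big_set_mul_sub sE) => I; apply: (gen_sub sE) => _ [a Ka [b Kb <-]] /=.
set c := et a; set f := et b.
have Kc : capG d (I :&: S i.+1) c by apply: capS => //; exact: finset.subsetIr.
have Ka' : capG d (i |: I :&: S i.+1) (a * c^-1) by apply: capD => //; exact: finset.subsetIr.
have Kb' : capG d (i |: S i.+1 :\: I) (b * f^-1) by apply: capD => //; exact: finset.subsetDl.
(* Replace first [a] by [c] and then [b] by [f]. The correction [a * c^-1] is also killed by [d_i],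
   so [i] joins [I]; the correction [b * f^-1] lets [i] join the complement. *)
have Dab : D i [~ a * c^-1, b].
  apply: (@D_comm i (i |: I)).
    move: Ka'; congr (capG d _ _); rewrite SE; apply/setP=> j; rewrite !inE.
    by case: (j == i).
  move: Kb; congr (capG d _ _); rewrite SE; apply/setP=> j; rewrite !inE.
  by case: eqP => // ->; rewrite ltnn andbF.
have Dcb : D i [~ c, b * f^-1].
  apply: (@D_comm i (I :\ i)).
    move: Kc; congr (capG d _ _); rewrite SE; apply/setP=> j; rewrite !inE.
    by case: eqP => // ->; rewrite ltnn andbF.
  move: Kb'; congr (capG d _ _); rewrite SE; apply/setP=> j; rewrite !inE.
  by case: (j == i).
have -> : [~ a, b] * (et [~ a, b])^-1 =
    [~ a * c^-1, b] ^ c * ([~ c, b * f^-1] ^ f) ^ [~ c, f]^-1.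
  rewrite gmulfR -/c -/f -{1}[a](mulgVK c) commMgJ -{2}[b](mulgVK f) commgMJ.
  by rewrite [_ ^ [~ c, f]^-1]conjgE invgK -[LHS]mulgA -[(_ * _) * [~ c, f]^-1]mulgA.
by apply: DM; [apply: DJ|apply: (DJ); exact: DJ].
Qed.

(** Together with [hopf_den_sub_num], numerator and denominator agree for split faces. The faces are
    taken into account one at a time, from the last to the first, by [D_step]. *)
Lemma hopf_num_sub_den : hopf_num d `<=` hopf_den d.
Proof.
move=> x [Rx Kx].
suff: forall t, (t <= n)%N -> D (n - t)%N x.
  move=> /(_ n (leqnn n)); rewrite subnn.
  have -> // : D 0 = hopf_den d.
  rewrite /D /KH /hopf_den; congr (set_mul (_ @` _) _).
    by apply: eq_bigcapl; split=> // j _; rewrite /= inE.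
  apply: eq_bigr => I _.
  have -> : I :&: S 0 = I by apply/setP=> j; rewrite !inE andbT.
  by have -> // : S 0 :\: I = ~: I by apply/setP=> j; rewrite !inE andbT.
elim=> [_|t IHt lt_tn].
  (* At level [n] no face is left: all intersections are the whole group, and the empty [I] already
     gives every commutator. *)
  rewrite subn0; case: (D_normal n) => -[_ DM DV] _.
  have capn (I : {set 'I_n}) a : I \subset S n -> capG d I a.
    move=> /fintype.subsetP IS j /IS; rewrite inE leqNgt ltn_ord //.
  case: Rx => _ [r _ <-] [c cc <-]; apply: DM; last first.
    apply: gen_sub cc => //; first by case: (D_normal n).
    move=> _ [a _ [b _ <-]].
    by apply: (@D_comm n finset.set0); apply: capn; rewrite ?finset.subsetIr ?finset.subsetDl.
  by apply: D_mu => j; rewrite /= inE leqNgt ltn_ord.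
have E : ((n - t.+1).+1 = n - t)%N by rewrite -subSn.
have lt_i : (n - t.+1 < n)%N by rewrite E leq_subr.
apply: (D_step (i := Ordinal lt_i)) => /=; last exact: Kx.
by rewrite E; apply: IHt; exact: ltnW.
Qed.
End SplitHopf.

(** * Simplicial identities of the cotriple resolution *)

Section XmodEquality.
Variables X Y Z : xmod.
Implicit Types (f g : xmod_hom X Y).

Lemma xeq_map f g : xeq f g <-> (forall x, xmod_map f x = xmod_map g x).
Proof.
split=> [[fg_rho fg_tau] [h k]|fg]; first by congr pair; [exact: fg_rho|exact: fg_tau].
by split=> [h|k]; [case: (fg (h, 1%g))|case: (fg (1%g, k))].
Qed.
End XmodEquality.

Definition free_xmod_map (U V : choiceType) (phi : U -> V) :
  xmod_hom (free_xmod U) (free_xmod V) := free_xmod_lift (fun x => free_xmod_unit (phi x)).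

Lemma free_xmod_hom_ext (U : choiceType) (Y : xmod) (f g : xmod_hom (free_xmod U) Y) :
  (forall x, xmod_map f (free_xmod_unit x) = xmod_map g (free_xmod_unit x)) -> xeq f g.
Proof.
move=> fg; have [fr ft] := free_xmod_lift_uniq fg.
have [gr gt] := free_xmod_lift_uniq (fun x => erefl (xmod_map g (free_xmod_unit x))).
by split=> u; rewrite ?fr ?gr ?ft ?gt.
Qed.

Lemma free_xmod_map_unit (U V : choiceType) (phi : U -> V) x :
  xmod_map (free_xmod_map phi) (free_xmod_unit x) = free_xmod_unit (phi x).
Proof. exact: free_xmod_lift_unit. Qed.

Lemma free_xmod_map_comp (U V W : choiceType) (phi : U -> V) (psi : V -> W) :
  xeq (xmod_comp (free_xmod_map psi) (free_xmod_map phi)) (free_xmod_map (psi \o phi)).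
Proof.
apply: free_xmod_hom_ext => x.
rewrite -[LHS]/(xmod_map (free_xmod_map psi) (xmod_map (free_xmod_map phi) (free_xmod_unit x))).
by rewrite !free_xmod_map_unit.
Qed.

Lemma free_xmod_map_ext (U V : choiceType) (phi psi : U -> V) :
  phi =1 psi -> xeq (free_xmod_map phi) (free_xmod_map psi).
Proof. by move=> E; apply: free_xmod_hom_ext => x; rewrite !free_xmod_map_unit E. Qed.

Lemma free_xmod_map_id (U : choiceType) : xeq (free_xmod_map id) (xmod_id (free_xmod U)).
Proof. by apply: free_xmod_hom_ext => x; rewrite free_xmod_map_unit. Qed.

Lemma cotriple_mapE (Y Z : xmod) (f : xmod_hom Y Z) :
  cotriple_map f = free_xmod_map (xmod_map f).
Proof. by []. Qed.

Lemma cotriple_counit_unit (Y : xmod) (x : xmod_set Y) :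
  xmod_map (cotriple_counit Y) (free_xmod_unit x) = x.
Proof. exact: free_xmod_lift_unit. Qed.

Lemma cotriple_counit_natural (Y Z : xmod) (f : xmod_hom Y Z) :
  xeq (xmod_comp f (cotriple_counit Y)) (xmod_comp (cotriple_counit Z) (cotriple_map f)).
Proof.
apply: free_xmod_hom_ext => x.
rewrite -[LHS]/(xmod_map f (xmod_map (cotriple_counit Y) (free_xmod_unit x))).
rewrite -[RHS]/(xmod_map (cotriple_counit Z) (xmod_map (cotriple_map f) (free_xmod_unit x))).
by rewrite cotriple_mapE free_xmod_map_unit !cotriple_counit_unit.
Qed.

Section CotripleIdentities.
Variable X : xmod.
Local Notation P k := (cotriple_iter k X).
Local Notation face k i := (cotriple_face k i X).

Lemma cotriple_face0 k : face k 0 = cotriple_counit (P k).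
Proof. by case: k. Qed.

Lemma cotriple_faceS k i : face k.+1 i.+1 = cotriple_map (face k i).
Proof. by []. Qed.

Lemma cotriple_face_face0 k i :
  xeq (xmod_comp (face k i) (face k.+1 0)) (xmod_comp (face k 0) (face k.+1 i.+1)).
Proof. rewrite cotriple_faceS !cotriple_face0; exact: cotriple_counit_natural. Qed.

(** The case [i = 0] is naturality of the counit, and applying [P] raises all indices by one. The
    bound [j <= k] keeps to the genuine faces, since [cotriple_face] has default values beyond. *)
Lemma cotriple_face_face k i j (x : xmod_set (P k.+2)) : (i <= j <= k)%N ->
  xmod_map (face k i) (xmod_map (face k.+1 j.+1) x) =
  xmod_map (face k j) (xmod_map (face k.+1 i) x).
Proof.
elim: k i j x => [|k IHk] i j x.
  move=> le_ij; have [-> ->] : i = 0%N /\ j = 0%N by lia.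
  by symmetry; have /xeq_map/(_ x) := cotriple_face_face0 0 0.
case: i => [|i]; first by move=> _; symmetry; have /xeq_map/(_ x) := cotriple_face_face0 k.+1 j.
case: j => [|j] le_ijk; first by exfalso; lia.
have := free_xmod_map_comp (xmod_map (face k.+1 j.+1)) (xmod_map (face k i)).
have := free_xmod_map_comp (xmod_map (face k.+1 i)) (xmod_map (face k j)).
move=> /xeq_map/(_ x) Ei /xeq_map/(_ x) Ej.
rewrite (cotriple_faceS k.+1 j.+1) (cotriple_faceS k.+1 i) !cotriple_faceS !cotriple_mapE.
rewrite [LHS]Ej [RHS]Ei; apply: (xeq_map _ _).1.
by apply: free_xmod_map_ext => y; exact: IHk.
Qed.

(** Indices are shifted by one: index [i.+1] is the degeneracy [s_i], a map induced by one of sets,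
    while index [0] is the extra degeneracy given by the unit of the adjunction, which is not a
    homomorphism. *)
Fixpoint cotriple_degen (Y : xmod) k i :
    xmod_set (cotriple_iter k Y) -> xmod_set (cotriple_iter k.+1 Y) :=
  match k, i return xmod_set (cotriple_iter k Y) -> xmod_set (cotriple_iter k.+1 Y) with
  | k'.+1, i'.+1 => xmod_map (free_xmod_map (cotriple_degen (k := k') i'))
  | k', _ => fun x => free_xmod_unit x
  end.
Arguments cotriple_degen {Y} k i x.

Lemma cotriple_degen0 k (x : xmod_set (P k)) : cotriple_degen k 0 x = free_xmod_unit x.
Proof. by case: k x. Qed.

Lemma cotriple_degenK k i (x : xmod_set (P k)) : (i <= k)%N ->
  xmod_map (face k i) (cotriple_degen k i x) = x.
Proof.
elim: k i x => [|k IHk] [|i] x // le_ik.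
- by rewrite cotriple_face0 cotriple_degen0 cotriple_counit_unit.
- by rewrite cotriple_face0 cotriple_degen0 cotriple_counit_unit.
rewrite cotriple_faceS cotriple_mapE.
have /xeq_map/(_ x) := free_xmod_map_comp (cotriple_degen k i) (xmod_map (face k i)).
move=> E; rewrite [LHS]E.
have /free_xmod_map_ext/xeq_map -> : xmod_map (face k i) \o cotriple_degen k i =1 id.
  by move=> y; exact: IHk.
by have /xeq_map -> := free_xmod_map_id (xmod_set (P k)); case: x {E}.
Qed.

Lemma cotriple_face_degen k i j (x : xmod_set (P k.+1)) : (i <= j <= k)%N ->
  xmod_map (face k.+1 j.+1) (cotriple_degen k.+1 i x) =
  cotriple_degen k i (xmod_map (face k j) x).
Proof.
elim: k i j x => [|k IHk] i j x le_ijk; (case: i le_ijk => [|i] le_ijk;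
  first by rewrite !cotriple_degen0 cotriple_faceS cotriple_mapE free_xmod_map_unit).
  by exfalso; lia.
case: j le_ijk => [|j] le_ijk; first by exfalso; lia.
rewrite (cotriple_faceS k.+1) cotriple_faceS !cotriple_mapE.
have /xeq_map/(_ x) Ej := free_xmod_map_comp (cotriple_degen k.+1 i) (xmod_map (face k.+1 j.+1)).
have /xeq_map/(_ x) Ei := free_xmod_map_comp (xmod_map (face k j)) (cotriple_degen k i).
rewrite [LHS]Ej [RHS]Ei; apply: (xeq_map _ _).1.
by apply: free_xmod_map_ext => y; exact: IHk.
Qed.

(** The sections are the [s_i]: one has [d_(i+1) s_i = 1], and for [j > i] also [d_(j+1) s_i d_(i+1)
    = s_i d_j d_(i+1) = s_i d_(i+1) d_(j+1)]. *)
Lemma cotriple_split_faces k :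
  split_faces (fun i : 'I_k => cotriple_face k i.+1 X).
Proof.
case: k => [|k] i; first by case: i.
exists (free_xmod_map (cotriple_degen k i)); split=> [|j lt_ij].
  apply/xeq_map => x.
  have /xeq_map/(_ x) E := free_xmod_map_comp (cotriple_degen k i) (xmod_map (face k i)).
  rewrite [LHS]E.
  have /free_xmod_map_ext/xeq_map -> : xmod_map (face k i) \o cotriple_degen k i =1 id.
    by move=> y; apply: cotriple_degenK; rewrite -ltnS.
  by have /xeq_map -> := free_xmod_map_id (xmod_set (P k)).
case: j lt_ij => -[//|j] /= lt_jk le_ij; rewrite ltnS in lt_jk.
case: k i lt_jk le_ij => [//|k] i lt_jk le_ij; rewrite ltnS in le_ij.
exists (free_xmod_map (cotriple_degen k i \o xmod_map (face k i))).
apply/xeq_map => x.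
have C (U V W : choiceType) (phi : U -> V) (psi : V -> W) y :
    xmod_map (free_xmod_map psi) (xmod_map (free_xmod_map phi) y) =
    xmod_map (free_xmod_map (psi \o phi)) y.
  by have /xeq_map/(_ y) := free_xmod_map_comp phi psi.
transitivity (xmod_map (free_xmod_map (xmod_map (face k.+1 j.+1)))
  (xmod_map (free_xmod_map (cotriple_degen k.+1 i)) (xmod_map (free_xmod_map (xmod_map (face k.+1 i))) x))).
  by [].
transitivity (xmod_map (free_xmod_map (cotriple_degen k i \o xmod_map (face k i)))
  (xmod_map (free_xmod_map (xmod_map (face k.+1 j.+1))) x)); last by [].
rewrite !C; apply: (xeq_map _ _).1; apply: free_xmod_map_ext => y /=.
have le_ijk : (i <= j <= k)%N by rewrite le_ij.
by rewrite cotriple_face_degen // cotriple_face_face.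
Qed.
End CotripleIdentities.

(** * The contraction of the resolution on underlying sets *)

Section Contraction.
Local Open Scope group_scope.
Variable Y : xmod.

(* Together these contract the cotriple resolution as a simplicial set; neither
   of them is a homomorphism. *)
Definition secH (h : xH Y) : xH (cotriple Y) := (free_xmod_unit ((h, 1) : xmod_set Y)).1.
Definition secG (g : xG Y) : xG (cotriple Y) := (free_xmod_unit ((1, g) : xmod_set Y)).2.

Lemma secHK : cancel secH (rho (cotriple_counit Y)).
Proof. by move=> h; have [] := cotriple_counit_unit ((h, 1) : xmod_set Y). Qed.

Lemma secGK : cancel secG (tau (cotriple_counit Y)).
Proof. by move=> g; have [] := cotriple_counit_unit ((1, g) : xmod_set Y). Qed.
End Contraction.

Lemma secH_natural (Y Z : xmod) (f : xmod_hom Y Z) h :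
  rho (cotriple_map f) (secH h) = secH (rho f h).
Proof.
have /(congr1 fst) := free_xmod_map_unit (xmod_map f) ((h, 1%g) : xmod_set Y).
by rewrite /xmod_map /= gmulf1.
Qed.

Lemma secG_natural (Y Z : xmod) (f : xmod_hom Y Z) g :
  tau (cotriple_map f) (secG g) = secG (tau f g).
Proof.
have /(congr1 snd) := free_xmod_map_unit (xmod_map f) ((1%g, g) : xmod_set Y).
by rewrite /xmod_map /= gmulf1.
Qed.

(** * The bar resolution of a free group *)

Section BarResolution.
Variable G : groupType.
Implicit Types (m : nat) (g : G).

Definition bact m g : bar G m -> bar G m := freeg_map (bar_act g).
HB.instance Definition _ m g := GRing.Additive.on (@bact m g).

Lemma bactU m g (t : m.+1.-tuple G) : bact g << t >> = << bar_act g t >>.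
Proof. exact: freeg_mapU. Qed.

Lemma bactM m g g' (b : bar G m) : bact (g * g')%g b = bact g (bact g' b).
Proof.
elim/freeg_zind: b => [t||x y gx gy]; [|by rewrite !raddf0|by rewrite !raddfB /= gx gy].
rewrite !bactU; congr << _ >>; apply: eq_bar_tuple => j lt_jm.
by rewrite !nth_bar_act //; case: ifP => // _; rewrite mulgA.
Qed.

Lemma bact1 m (b : bar G m) : bact 1%g b = b.
Proof.
elim/freeg_zind: b => [t||x y gx gy]; [|by rewrite !raddf0|by rewrite !raddfB /= gx gy].
rewrite !bactU; congr << _ >>; apply: eq_bar_tuple => j lt_jm.
by rewrite !nth_bar_act //; case: ifP => // _; rewrite mul1g.
Qed.

Lemma bact_d m g (b : bar G m.+1) : bar_d (bact g b) = bact g (bar_d b).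
Proof. exact: bar_d_act. Qed.

Lemma bar_dU m (t : m.+2.-tuple G) :
  bar_d << t >> = \sum_(i < m.+2) << bar_face i t >> *~ (-1) ^+ i.
Proof. by rewrite /bar_d /alt_sum; apply: eq_bigr => i _; rewrite /= freeg_mapU. Qed.

Lemma bar_dU1 (t : 2.-tuple G) :
  bar_d << t >> = << bar_face 0 t >> - << bar_face 1 t >>.
Proof.
rewrite bar_dU !big_ord_recl big_ord0 /bump /= !exprS expr0 !mulr1.
by rewrite mulr1z mulrN1z addr0.
Qed.

Lemma bar_dU2 (t : 3.-tuple G) :
  bar_d << t >> = << bar_face 0 t >> - << bar_face 1 t >> + << bar_face 2 t >>.
Proof.
rewrite bar_dU !big_ord_recl big_ord0 /bump /= !exprS expr0 !mulr1 mulrN1 opprK.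
by rewrite !mulr1z mulrN1z addr0 addrA.
Qed.

(** The usual contraction of the bar resolution as a complex of abelian groups; it is not
    equivariant in general, whence [homogenize]. *)
Definition bar_cons m : bar G m -> bar G m.+1 := freeg_map (fun t : m.+1.-tuple G => [tuple of 1%g :: t]).
HB.instance Definition _ m := GRing.Additive.on (@bar_cons m).

Lemma bar_consU m (t : m.+1.-tuple G) : bar_cons << t >> = << [tuple of 1%g :: t] >>.
Proof. exact: freeg_mapU. Qed.

Lemma bar_d_cons m (b : bar G m.+1) : bar_d (bar_cons b) = b - bar_cons (bar_d b).
Proof.
elim/freeg_zind: b => [t||x y gx gy]; last 2 first.
- by rewrite !raddf0 addr0.
- by rewrite !raddfB /= gx gy opprD addrACA -opprD.
rewrite bar_consU !bar_dU big_ord_recl /= mulr1z; congr (_ + _).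
  congr << _ >>; apply: eq_bar_tuple => j lt_jm; rewrite nth_bar_face //=.
  by case: j lt_jm => [|j] //= _; rewrite mul1g.
rewrite raddf_sum -sumrN; apply: eq_bigr => i _.
rewrite raddfMz /= exprS mulN1r mulrNz bar_consU; congr (- (<< _ >> *~ _)).
apply: eq_bar_tuple => j lt_jm; rewrite nth_bar_face //=.
case: j lt_jm => [|j] lt_jm //=; rewrite /bump add1n ltnS eqSS.
by rewrite nth_bar_face.
Qed.

Definition equivariant m m' (phi : bar G m -> bar G m') :=
  forall g b, phi (bact g b) = bact g (phi b).

Section Homogenize.
Variables (m m' : nat) (phi : {additive bar G m -> bar G m'}).

(* The equivariant map agreeing with [phi] on the basis elements [(1, g_1, ..., g_m)]. *)
Definition homogenize : bar G m -> bar G m' :=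
  zlift (fun t : m.+1.-tuple G =>
    bact (nth 1%g t 0) (phi (bact (nth 1%g t 0)^-1%g << t >>))).
HB.instance Definition _ := GRing.Additive.on homogenize.

Lemma homogenizeU t : homogenize << t >> =
  bact (nth 1%g t 0) (phi (bact (nth 1%g t 0)^-1%g << t >>)).
Proof. exact: zliftU. Qed.

Lemma homogenize_equivariant : equivariant homogenize.
Proof.
move=> g b.
elim/freeg_zind: b => [t||x y gx gy]; [|by rewrite !raddf0|by rewrite !raddfB /= gx gy].
rewrite bactU !homogenizeU -bactU nth_bar_act //=.
by rewrite invgM bactM -[bact (_ * _)%g (bact g _)]bactM mulgVK.
Qed.
End Homogenize.

Definition bar_homotopy m (k : bar G m.+1 -> bar G m.+1)
    (h : {additive bar G m.+1 -> bar G m.+2}) :=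
  equivariant h /\ forall b, bar_d (h b) = b - k b.

(** Each [b - k b] is a cycle, hence the boundary of its image under [bar_cons]. Homogenizing keeps
    this identity because [bar_d] and [k] are equivariant. *)
Lemma bar_homotopy_exists m (k : {additive bar G m.+1 -> bar G m.+1}) :
  equivariant k -> (forall b, bar_d (k b) = bar_d b) -> exists h, bar_homotopy k h.
Proof.
move=> kE dk; pose phi := @bar_cons m.+1 \o (idfun \- k).
exists (homogenize phi); split; first exact: homogenize_equivariant.
move=> b; elim/freeg_zind: b => [t||x y gx gy]; last 2 first.
- by rewrite !raddf0 addr0.
- by rewrite !raddfB /= gx gy opprD addrACA -opprD.
rewrite /= homogenizeU bact_d /phi /= bar_d_cons.
rewrite [bar_d (_ - _)]raddfB /= dk subrr raddf0 subr0.
by rewrite kE raddfB /= -!bactM mulgV !bact1.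
Qed.
End BarResolution.

Section FreeGroupBar.
Variable X : choiceType.
Local Notation Q := (free_group X).

(** An inverse letter follows the rule that the derivative of [x^-1] is [- x^-1 [x]]. *)
Definition fox_letter (a : bool * X) : bar Q 1 :=
  if a.1 then - << [tuple (free_gen a.2)^-1%g; free_gen a.2] >>
  else << [tuple 1%g; free_gen a.2] >>.

Definition fox_word (w : seq (bool * X)) : bar Q 1 :=
  foldr (fun a b => fox_letter a + bact (letter_eval (@free_gen X) a) b) 0 w.

(* The Fox derivative: the crossed homomorphism with [fox x = [x]] on generators. *)
Definition fox (u : Q) : bar Q 1 := fox_word (free_word u).

Lemma fox_push a w : fox_word (free_push a w) =
  fox_letter a + bact (letter_eval (@free_gen X) a) (fox_word w).
Proof.
case: w => [|b w] //=; case: eqP => [->|] //=.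
rewrite [bact _ (_ + _)]raddfD /= addrA -bactM letter_eval_inv mulgV bact1.
suff -> : fox_letter a + bact (letter_eval (@free_gen X) a) (fox_letter (letter_inv a)) = 0.
  by rewrite add0r.
case: a => [[] x]; rewrite /fox_letter /letter_eval /=; last rewrite raddfN /=.
  rewrite bactU addrC; apply/eqP; rewrite subr_eq0; apply/eqP; congr << _ >>.
  by apply: eq_bar_tuple => -[|[|j]] // _; rewrite nth_bar_act //= mulg1.
rewrite bactU; apply/eqP; rewrite subr_eq0; apply/eqP; congr << _ >>.
by apply: eq_bar_tuple => -[|[|j]] // _; rewrite nth_bar_act //= mulgV.
Qed.

Lemma free_lift_free_gen (u : Q) : free_lift (@free_gen X) u = u.
Proof. by symmetry; apply: (free_lift_uniq (h := idfun)). Qed.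

Lemma foxM u v : fox (u * v)%g = fox u + bact u (fox v).
Proof.
rewrite -{3}[u]free_lift_free_gen /fox /free_lift /=.
elim: (free_word u) => [|a w IHw] /=; first by rewrite big_nil bact1 add0r.
by rewrite fox_push IHw big_cons raddfD /= bactM addrA.
Qed.

Lemma d_fox u : bar_d (fox u) = << [tuple u] >> - << [tuple 1%g] >>.
Proof.
have dl a : bar_d (fox_letter a) =
    << [tuple letter_eval (@free_gen X) a] >> - << [tuple 1%g] >>.
  case: a => [[] x]; rewrite /fox_letter /letter_eval /= ?raddfN /= bar_dU1 ?opprB;
  congr (<< _ >> - << _ >>); apply: eq_bar_tuple => -[|j] // _;
  by rewrite nth_bar_face //= ?mulVg ?mul1g.
rewrite -[in RHS](free_lift_free_gen u) /fox /free_lift.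
elim: (free_word u) => [|a w IHw]; first by rewrite big_nil raddf0 subrr.
rewrite big_cons /= raddfD /= bact_d IHw dl raddfB /= !bactU.
have actE g g' : bar_act g [tuple g' : Q] = [tuple (g * g')%g].
  by apply: eq_bar_tuple => -[|j] // _; rewrite nth_bar_act.
by rewrite !actE mulg1 addrC addrA subrK.
Qed.

(** An equivariant projection onto the submodule spanned by the brackets of the free generators. *)
Definition fox_lin : bar Q 1 -> bar Q 1 :=
  zlift (fun t : 2.-tuple Q => bact (nth 1%g t 0) (fox (nth 1%g t 1))).
HB.instance Definition _ := GRing.Additive.on fox_lin.

Lemma fox_lin_equivariant : equivariant fox_lin.
Proof.
move=> g b.
elim/freeg_zind: b => [t||x y gx gy]; [|by rewrite !raddf0|by rewrite !raddfB /= gx gy].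
by rewrite bactU /fox_lin !zliftU !nth_bar_act //= bactM.
Qed.

Lemma d_fox_lin b : bar_d (fox_lin b) = bar_d b.
Proof.
elim/freeg_zind: b => [t||x y gx gy]; [|by rewrite !raddf0|by rewrite !raddfB /= gx gy].
rewrite /fox_lin zliftU bact_d d_fox bar_dU1.
rewrite raddfB /= !bactU; congr (<< _ >> - << _ >>);
by apply: eq_bar_tuple => -[|j] // _; rewrite nth_bar_face // nth_bar_act //= ?mulg1.
Qed.

Lemma fox_lin_d (b : bar Q 2) : fox_lin (bar_d b) = 0.
Proof.
elim/freeg_zind: b => [t||x y gx gy]; [|by rewrite !raddf0|by rewrite !raddfB /= gx gy subr0].
rewrite bar_dU2 !raddfD raddfN /= /fox_lin !zliftU !nth_bar_face //=.
rewrite foxM [bact _ (_ + _)]raddfD /= -bactM.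
by rewrite opprD addrCA subrr addr0 addNr.
Qed.

(** Start with [k = fox_lin]. One degree higher use [k' = h d]: then [d k' = d - k d = d], and [k']
    kills boundaries because [d d = 0]. *)
Lemma free_bar_homotopy m : exists (k : {additive bar Q m.+1 -> bar Q m.+1})
  (h : {additive bar Q m.+1 -> bar Q m.+2}),
  bar_homotopy k h /\ forall c, k (bar_d c) = 0.
Proof.
elim: m => [|m [k [h [[hE dh] kd]]]].
  have [h hP] := bar_homotopy_exists fox_lin_equivariant d_fox_lin.
  by exists fox_lin, h; split=> //; exact: fox_lin_d.
pose k' := h \o @bar_d Q m.+1.
have k'E : equivariant k' by move=> g b; rewrite /k' /= bact_d hE.
have dk' b : bar_d (k' b) = bar_d b by rewrite /k' /= dh kd subr0.
have [h' hP] := bar_homotopy_exists k'E dk'.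
by exists k', h'; split=> // c; rewrite /k' /= bar_dK raddf0.
Qed.

Lemma free_bar_contraction m : exists (h : {additive bar Q m.+1 -> bar Q m.+2})
  (h' : {additive bar Q m.+2 -> bar Q m.+3}),
  [/\ equivariant h, equivariant h' & forall b, bar_d (h' b) = b - h (bar_d b)].
Proof.
have [k [h [[hE dh] kd]]] := free_bar_homotopy m.
pose k' := h \o @bar_d Q m.+1.
have k'E : equivariant k' by move=> g b; rewrite /k' /= bact_d hE.
have dk' b : bar_d (k' b) = bar_d b by rewrite /k' /= dh kd subr0.
have [h' [h'E dh']] := bar_homotopy_exists k'E dk'.
by exists h, h'.
Qed.

(** A free group has no homology above degree 1. The boundary of a representative vanishes only
    among coinvariants, and equivariance of [h] carries this over to [h (bar_d b)]. *)
Lemma free_coinv_exact m (x : bar_coinv Q m.+2) : coinv_d x = 0 ->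
  exists y, coinv_d y = x.
Proof.
have [h [h' [hE h'E dh']]] := free_bar_contraction m.
have [b ->] := cpi_surj x; rewrite /cpi coinv_dE => /cpi_eq0 db.
exists (cpi (h' b)); rewrite /cpi coinv_dE -!/(cpi _) dh' raddfB /=.
suff -> : cpi (h (bar_d b)) = 0 by rewrite subr0.
by apply/cpi_eq0/(coinv_rel_equivariant (f := idfun)).
Qed.
End FreeGroupBar.

(** * The nerve of a free crossed module *)

Section Single.
Variable C : bicomplex.

Lemma in_degreeB k (x y : bifamily C) : in_degree k x -> in_degree k y -> in_degree k (x - y).
Proof. by move=> xk yk p q pq; rewrite -[LHS]/(x p q - y p q) xk // yk // subrr. Qed.

Lemma in_degreeD k (x y : bifamily C) : in_degree k x -> in_degree k y -> in_degree k (x + y).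
Proof. by move=> xk yk p q pq; rewrite -[LHS]/(x p q + y p q) xk // yk // addr0. Qed.

Definition single p0 q0 (u : C p0 q0) : bifamily C := fun p q =>
  match p0 =P p, q0 =P q with
  | ReflectT ep, ReflectT eq => eq_rect q0 (C p) (eq_rect p0 (C^~ q0) u p ep) q eq
  | _, _ => 0
  end.

Lemma singleE p q (u : C p q) : single u p q = u.
Proof.
rewrite /single; case: eqP => // ep; case: eqP => // eq.
by rewrite !eq_axiomK.
Qed.

Lemma single_neq p0 q0 (u : C p0 q0) p q : (p0, q0) != (p, q) -> single u p q = 0.
Proof.
rewrite /single; case: eqP => // ep; case: eqP => // eq.
by case/eqP; rewrite ep eq.
Qed.

Lemma single_zmod_morphism p0 q0 : zmod_morphism (@single p0 q0).
Proof.
move=> u v; apply: bifamily_ext => p q.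
rewrite -[RHS]/(single u p q - single v p q).
have [[<- <-]|neq] := eqVneq (p0, q0) (p, q); first by rewrite !singleE.
by rewrite !single_neq // subr0.
Qed.
HB.instance Definition _ p0 q0 :=
  GRing.isZmodMorphism.Build _ _ (@single p0 q0) (@single_zmod_morphism p0 q0).

Lemma single_degree k p q (u : C p q) : (p + q)%N = k -> in_degree k (single u).
Proof.
move=> <- p' q' neq; apply: single_neq; apply: contraNneq neq => -[<- <-]; exact: eqxx.
Qed.

Lemma tot_d_single0 q (u : C 0 q.+1) : tot_d (single u) = single (bico_v C 0 q u).
Proof.
apply: bifamily_ext => p' q'; rewrite /tot_d [single u p'.+1 q']single_neq // raddf0 add0r.
have [[<- <-]|neq] := eqVneq (0%N, q) (p', q'); first by rewrite !singleE mulr1z.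
rewrite !single_neq ?raddf0 ?mul0rz //; apply: contraNneq neq => -[<- <-]; exact: eqxx.
Qed.

Lemma tot_d_singleS0 p (u : C p.+1 0) : tot_d (single u) = single (bico_h C p 0 u).
Proof.
apply: bifamily_ext => p' q'; rewrite /tot_d [single u p' q'.+1]single_neq; last first.
  by apply/negP=> /eqP[].
rewrite raddf0 mul0rz addr0.
have [[<- <-]|neq] := eqVneq (p, 0%N) (p', q'); first by rewrite !singleE.
rewrite !single_neq ?raddf0 //; apply: contraNneq neq => -[<- <-]; exact: eqxx.
Qed.

Lemma tot_d_singleSS p q (u : C p.+1 q.+1) : tot_d (single u) =
  single (bico_h C p q.+1 u) + single (bico_v C p.+1 q u *~ (-1) ^+ p.+1).
Proof.
apply: bifamily_ext => p' q'.
rewrite -[RHS]/(single (bico_h C p q.+1 u) p' q' +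
  single (bico_v C p.+1 q u *~ (-1) ^+ p.+1) p' q') /tot_d.
congr (_ + _).
  have [[<- <-]|neq] := eqVneq (p, q.+1) (p', q'); first by rewrite !singleE.
  rewrite !single_neq ?raddf0 //; apply: contraNneq neq => -[<- <-]; exact: eqxx.
have [[<- <-]|neq] := eqVneq (p.+1, q) (p', q'); first by rewrite !singleE.
rewrite !single_neq ?raddf0 ?mul0rz //; apply: contraNneq neq => -[<- <-]; exact: eqxx.
Qed.
End Single.

Lemma tmap_single (Y Z : xmod) (a : xH Y -> xH Z) (b : xG Y -> xG Z) p q
    (u : xmod_bicomplex Y p q) :
  tmap a b (single u) = @single (xmod_bicomplex Z) p q (csmap (nmap a b p) u).
Proof.
apply: bifamily_ext => p' q'; rewrite /tmap.
have [[<- <-]|neq] := eqVneq (p, q) (p', q'); first by rewrite !singleE.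
by rewrite !single_neq // raddf0.
Qed.

Section SplitNerve.
Variables (Y : xmod) (Q : groupType) (pr : {ghom xG Y -> Q}) (s : {ghom Q -> xG Y}).
Variable c : xG Y -> xH Y.
Hypothesis mu_inj : injective (xmu Y).
Hypothesis pr_mu : forall h, pr (xmu Y h) = 1%g.
Hypothesis mu_c : forall g, xmu Y (c g) = (s (pr g) * g^-1)%g.

Let c_mu h g : (c (xmu Y h * g) * h = c g)%g.
Proof.
by apply: mu_inj; rewrite gmulfM !mu_c gmulfM pr_mu mul1g invgM -!mulgA mulVg mulg1.
Qed.

(* Under the identification of [Ner_p] with the [p+1]-fold fibre power of [G] over
   [Q], this is [(g_0, ..., g_p) |-> (s (pr g_0), g_0, ..., g_p)]. *)
Definition ner_extra p (x : Ner Y p) : Ner Y p.+1 := Sdp _ (c (ner_to_base Y p x)) x.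

Lemma ner_extra_monoid_morphism p : monoid.monoid_morphism (@ner_extra p).
Proof.
split=> [|x y].
  congr Sdp; apply: mu_inj; rewrite mu_c !gmulf1.
  by rewrite invg1 mulg1.
congr Sdp; apply: mu_inj => /=; rewrite -/(ner_to_base Y p).
rewrite !gmulfM xmuJ !mu_c -[omor (ner Y p) x]/(ner_to_base Y p x) !gmulfM.
by rewrite invgM !mulgA mulgVK.
Qed.
HB.instance Definition _ p := isUMagmaMorphism.Build (Ner Y p) (Ner Y p.+1)
  (@ner_extra p) (@ner_extra_monoid_morphism p).

Lemma ner_extra_face0 p (x : Ner Y p) : ner_face 0 (ner_extra x) = x.
Proof. by rewrite ner_face0E. Qed.

Lemma ner_extra_face01 (x : Ner Y 0) : ner_face 1 (ner_extra x) = s (pr x).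
Proof. by rewrite ner_face01E /= mu_c mulgVK. Qed.

Lemma ner_extra_faceS p i (x : Ner Y p.+1) :
  ner_face i.+1 (ner_extra x) = ner_extra (ner_face i x).
Proof.
case: i => [|i]; last by rewrite ner_faceSE /ner_extra ner_to_base_face.
by rewrite ner_face1E ner_face0E; congr Sdp; exact: c_mu.
Qed.

Local Notation C := (xmod_bicomplex Y).

Definition tot_extra (x : bifamily C) : bifamily C := fun p q =>
  match p return C p q with
  | 0 => 0
  | p'.+1 => csmap (@ner_extra p') (x p' q)
  end.

Lemma tot_extra_degree k x : in_degree k x -> in_degree k.+1 (tot_extra x).
Proof. by move=> xk [//|p] q pq; rewrite /tot_extra xk // raddf0. Qed.

(** From [d_0 h = 1] and [d_(i+1) h = h d_i] the horizontal sums cancel up to [x], except that in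
    column 0 the term [d_1 h = s pr] survives. The vertical terms cancel because the sign changes
    with [p]. *)
Lemma tot_extraP m x : in_degree m x ->
  tot_d (tot_extra x) + tot_extra (tot_d x) =
  x - @single C 0 m (csmap (s \o pr : Ner Y 0 -> Ner Y 0) (x 0%N m)).
Proof.
move=> xm; set y := single _.
have yE q : y 0%N q = csmap (s \o pr : Ner Y 0 -> Ner Y 0) (x 0%N q).
  have [->|neq] := eqVneq q m; first by rewrite /y singleE.
  by rewrite xm // raddf0 /y single_neq // xpair_eqE eq_sym.
apply: bifamily_ext => p q.
rewrite -[RHS]/(x p q - y p q).
rewrite -[LHS]/(tot_d (tot_extra x) p q + tot_extra (tot_d x) p q) /tot_d.
case: p => [|p] /=.
  rewrite raddf0 mul0rz !addr0 yE.
  rewrite /ner_bar_h /alt_sum !big_ord_recl big_ord0 /= addr0 mulr1z mulrN1z.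
  rewrite !coinv_map_csmap !csmap_comp; congr (_ - _).
    by apply: csmap_id => u; exact: ner_extra_face0.
  by apply: csmap_ext => u; exact: ner_extra_face01.
rewrite /y single_neq // subr0 raddfD raddfMz /=.
have -> : ner_bar_v (csmap (@ner_extra p) (x p q.+1)) =
    csmap (@ner_extra p) (ner_bar_v (x p q.+1)).
  by symmetry; exact: (csmap_d (@ner_extra p)).
rewrite exprS mulN1r mulrNz addrACA addNr addr0.
rewrite [ner_bar_h _]/alt_sum big_ord_recl /= mulr1z -[RHS]addr0 -addrA.
congr (_ + _).
  by rewrite coinv_map_csmap csmap_comp; apply: csmap_id => u; exact: ner_extra_face0.
rewrite [ner_bar_h (x _ _)]/alt_sum raddf_sum -big_split /=; apply: big1 => i _.
rewrite /bump /= raddfMz /= exprS mulN1r mulrNz !coinv_map_csmap !csmap_comp.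
rewrite (@csmap_ext _ _ _ (@ner_extra p \o @ner_face Y p i)) ?addNr // => u.
exact: ner_extra_faceS.
Qed.

Hypothesis Q_exact : forall m (x : bar_coinv Q m.+2), coinv_d x = 0 ->
  exists y, coinv_d y = x.

(** Up to a boundary, a cycle comes from its projection [w] to [Q] by the section [s]. The two faces
    from [Ner_1] to [Ner_0] agree after [pr], so [w] is a cycle and bounds. *)
Lemma split_tot_exact m (x : bifamily C) : in_degree m.+2 x -> tot_d x = 0 ->
  exists2 y, in_degree m.+3 y & tot_d y = x.
Proof.
move=> xm dx; pose w : bar_coinv Q m.+2 := csmap (pr : Ner Y 0 -> Q) (x 0%N m.+2).
have [|w' dw'] := Q_exact (x := w).
  have E0 : tot_d x 0%N m.+1 = 0 by rewrite dx.
  have := congr1 (csmap (pr : Ner Y 0 -> Q) (m := m.+1)) E0.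
  rewrite raddf0 /tot_d raddfD /= mulr1z => E.
  rewrite /w -(csmap_d pr) -[RHS]E -[LHS]add0r; congr (_ + _).
  symmetry.
  rewrite /ner_bar_h /alt_sum !big_ord_recl big_ord0 /= addr0 mulr1z mulrN1z.
  rewrite !coinv_map_csmap raddfB /= !csmap_comp.
  rewrite (@csmap_ext _ _ (_ \o @ner_face Y 0 0) (pr \o @ner_face Y 0 1)) ?subrr // => u.
  by rewrite /= ner_face0E ner_face01E gmulfM pr_mu mul1g.
exists (tot_extra x + @single C 0 m.+3 (csmap (s : Q -> Ner Y 0) w')).
  move=> p q pq.
  rewrite -[LHS]/(tot_extra x p q + @single C 0 m.+3 (csmap (s : Q -> Ner Y 0) w') p q).
  by rewrite (tot_extra_degree xm) // (single_degree _ (k := m.+3)) ?addr0.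
rewrite raddfD /= tot_d_single0.
have := tot_extraP xm; rewrite dx.
have -> : tot_extra 0 = 0.
  by apply: bifamily_ext => -[|p] q //=; rewrite raddf0.
rewrite addr0 => ->; rewrite -[RHS]addr0 -addrA; congr (_ + _).
apply/eqP; rewrite addrC subr_eq0; apply/eqP; congr single.
rewrite -[bico_v C 0 _ _]/(coinv_d (csmap s w')) -(csmap_d s) dw' /w.
exact: csmap_comp.
Qed.
End SplitNerve.

(** The second copy of [F_U] splits the projection of [F_U + F_U], whose kernel is the top group of
    the free crossed module. *)
Lemma free_xmod_tot_exact (U : choiceType) m (x : bifamily (xmod_bicomplex (free_xmod U))) :
  in_degree m.+2 x -> tot_d x = 0 ->
  exists2 y, in_degree m.+3 y & tot_d y = x.
Proof.
have pr_s : cancel (@freeFF_inr U) (@freeFF_proj U).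
  move=> w; rewrite [LHS](free_lift_uniq (f := @free_gen U)
    (h := @freeFF_proj U \o @freeFF_inr U)) ?free_lift_free_gen //.
  by move=> z; rewrite /= /freeFF_inr free_lift_gen /freeFF_proj free_lift_gen.
have cP (g : freeFF U) : freeFF_proj (freeFF_inr (freeFF_proj g) * g^-1)%g == 1%g.
  by rewrite gmulfM gmulfV /= pr_s mulgV.
pose c (g : freeFF U) : freeFF_ker U :=
    Sub (freeFF_inr (freeFF_proj g) * g^-1)%g (cP g).
apply: (@split_tot_exact (free_xmod U) (free_group U) (@freeFF_proj U) (@freeFF_inr U) c).
- exact: val_inj.
- by move=> h; exact/eqP/(valP h).
- by [].
- exact: free_coinv_exact.
Qed.

(** * Chains of low degree *)

Section AbelianQuotient.
Local Open Scope quotient_scope.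
Variables (G : groupType) (N : set G) (nN : normal N).
Hypothesis commN : forall x y, N [~ x, y]%g.

Definition abq_pred : normalPred G.
Proof.
refine (@NormalPred G (fun x => `[< N x >]) _ _ _ _).
- by case: nN => -[N1 _ _] _; exact/asboolP.
- by case: nN => -[_ NM _] _ x y /asboolP Nx /asboolP Ny; apply/asboolP/NM.
- by case: nN => -[_ _ NV] _ x /asboolP Nx; apply/asboolP/NV.
- by case: nN => _ NJ x y /asboolP Nx; apply/asboolP/NJ.
Defined.

Definition abq of (forall x y, N [~ x, y]%g) := quotg abq_pred.
Local Notation V := (abq commN).
HB.instance Definition _ := Choice.on V.

Let addA : associative (@quotg_mul G abq_pred : V -> V -> V).
Proof. exact: quotg_mulA. Qed.
Let addC : commutative (@quotg_mul G abq_pred : V -> V -> V).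
Proof.
elim/quotW=> x; elim/quotW=> y; rewrite -!quotg_piM; apply/quotg_piP/asboolP.
by rewrite invgM -!mulgA; have := commN y x; rewrite /commg /conjg !mulgA.
Qed.
Let add0 : left_id (quotg_one abq_pred : V) (@quotg_mul G abq_pred : V -> V -> V).
Proof. exact: quotg_mul1. Qed.
Let addN : left_inverse (quotg_one abq_pred : V) (@quotg_inv G abq_pred : V -> V)
  (@quotg_mul G abq_pred : V -> V -> V).
Proof. exact: quotg_mulV. Qed.
HB.instance Definition _ := GRing.isZmodule.Build V addA addC add0 addN.

Definition abq_pi (x : G) : V := \pi_(quotg abq_pred) x.

Lemma abq_piM x y : abq_pi (x * y)%g = abq_pi x + abq_pi y.
Proof. exact: quotg_piM. Qed.

Lemma abq_pi_eq0 x : abq_pi x = 0 <-> N x.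
Proof.
split=> [x0|Nx].
  have : abq_pi 1%g = abq_pi x by rewrite x0.
  by move=> /quotg_piP /asboolP; rewrite invg1 mul1g.
by symmetry; apply/quotg_piP/asboolP; rewrite invg1 mul1g.
Qed.
End AbelianQuotient.

Lemma coinv_dB (G : groupType) m (x y : bar_coinv G m.+1) :
  coinv_d (x - y) = coinv_d x - coinv_d y.
Proof. exact: raddfB. Qed.

Lemma subrDD_cancel (V : zmodType) (x y z p q : V) :
  x + p - (y + q) = z + (p - q - (z + y - x)).
Proof.
rewrite opprD addrACA opprB [z + y]addrC opprD [x + (- y - z)]addrA.
by rewrite [RHS]addrC [p - q + _]addrA subrK addrC.
Qed.

Section LowDegree.
Variable Y : xmod.
Local Notation C := (xmod_bicomplex Y).
Local Notation G := (Ner Y 0).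

Section Brackets.
Variable K : groupType.
Definition cls1 (a : K) : bar_coinv K 1 := cls [tuple 1%g; a].
Definition cls2 (a b : K) : bar_coinv K 2 := cls [tuple 1%g; a; b].

Lemma cls_normalize m (t : m.+1.-tuple K) :
  cls t = cls (bar_act (nth 1%g t 0)^-1%g t).
Proof. by rewrite cls_act. Qed.

Lemma cls1E (t : 2.-tuple K) : cls t = cls1 (nth 1%g t 1).
Proof.
rewrite cls_normalize /cls1; congr cls.
by apply: eq_bar_tuple => -[|[|j]] // _; rewrite nth_bar_act //= mulVg.
Qed.

Lemma coinv_dcls1 a : coinv_d (cls1 a) = 0.
Proof.
rewrite coinv_dcls !big_ord_recl big_ord0 addr0 /= mulr1z mulrN1z.
rewrite cls_normalize [X in _ - X]cls_normalize; apply/eqP; rewrite subr_eq0; apply/eqP.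
congr cls; apply: eq_bar_tuple => -[|j] // _.
by rewrite !nth_bar_act //= !mulVg.
Qed.

Lemma coinv_dcls2 a b : coinv_d (cls2 a b) = cls1 b - cls1 (a * b)%g + cls1 a.
Proof.
rewrite coinv_dcls !big_ord_recl big_ord0 addr0 /bump /= !exprS expr0 !mulr1.
rewrite mulrN1 opprK !mulr1z mulrN1z addrA.
by rewrite !cls1E !nth_bar_face.
Qed.
End Brackets.

Lemma csmap_cls1 (K L : groupType) (f : {ghom K -> L}) a : csmap f (cls1 a) = cls1 (f a).
Proof. by rewrite /cls1 csmapE cls1E (nth_map 1%g). Qed.

Lemma csmap_cls2 (K L : groupType) (f : {ghom K -> L}) a b :
  csmap f (cls2 a b) = cls2 (f a) (f b).
Proof.
rewrite /cls2 csmapE; congr cls.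
by apply: val_inj; rewrite /= gmulf1.
Qed.

(** Subtracting the class of [1] makes [beta] vanish at [1], so a face killing [a] kills [beta a].
    Likewise [beta2] is corrected to vanish as soon as one argument is [1]. *)
Definition beta_coef (a : G) : bar_coinv G 1 := cls1 a - cls1 1%g.
Definition beta (a : G) : bifamily C := @single C 0 1 (beta_coef a).
Definition beta2_coef (a b : G) : bar_coinv G 2 :=
  cls2 a b - cls2 a 1%g - (cls2 1%g b - cls2 1%g 1%g).
Definition beta2 (a b : G) : bifamily C := @single C 0 2 (beta2_coef a b).
Definition beta_mu (r : xH Y) : bifamily C :=
  @single C 1 1 (cls1 (Sdp _ r 1%g : Ner Y 1) - cls1 1%g).

Lemma beta_degree a : in_degree 1 (beta a). Proof. exact: single_degree. Qed.
Lemma beta2_degree a b : in_degree 2 (beta2 a b). Proof. exact: single_degree. Qed.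
Lemma beta_mu_degree r : in_degree 2 (beta_mu r). Proof. exact: single_degree. Qed.

Lemma beta1 : beta 1%g = 0.
Proof. by rewrite /beta /beta_coef subrr raddf0. Qed.

Lemma beta21 a : beta2 a 1%g = 0.
Proof. by rewrite /beta2 /beta2_coef !subrr raddf0. Qed.

Lemma beta2_1 b : beta2 1%g b = 0.
Proof. by rewrite /beta2 /beta2_coef subrr raddf0. Qed.

Lemma beta_mu1 : beta_mu 1%g = 0.
Proof. by rewrite /beta_mu subrr raddf0. Qed.

Lemma d_beta2 a b : tot_d (beta2 a b) = beta a + beta b - beta (a * b)%g.
Proof.
rewrite /beta2 tot_d_single0 /beta -raddfD -raddfB /=; congr single.
rewrite -[LHS]/(coinv_d _) /beta2_coef !coinv_dB !coinv_dcls2 !mulg1 !mul1g /beta_coef.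
set x := cls1 a; set y := cls1 b; set z := cls1 (a * b)%g; set o := cls1 1%g.
rewrite !subrK !subrr add0r subrr subr0 opprB -[RHS]addrA [y - o + _]addrA subrK.
by rewrite -addrA addrC.
Qed.

Lemma betaM a b : beta (a * b)%g = beta a + beta b - tot_d (beta2 a b).
Proof. by rewrite d_beta2 opprB addrC subrK. Qed.

Lemma d_beta_mu r : tot_d (beta_mu r) = - beta (xmu Y r).
Proof.
rewrite /beta_mu tot_d_singleSS [X in _ + single X](_ : _ = 0) ?raddf0 ?addr0; last first.
  by rewrite -[bico_v _ _ _ _]/(coinv_d _) coinv_dB !coinv_dcls1 subrr mul0rz.
rewrite /beta -[RHS]raddfN /=; congr single.
rewrite -[LHS]/(ner_bar_h _) raddfB /= /ner_bar_h /alt_sum !big_ord_recl !big_ord0.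
rewrite !addr0 /= !mulr1z !mulrN1z !coinv_map_csmap !csmap_cls1 !gmulf1.
transitivity (cls1 (1%g : G) - cls1 (xmu Y r : G) - (cls1 (1%g : G) - cls1 (1%g : G))).
  by congr (_ - cls1 _ - _); exact: mulg1.
by rewrite subrr subr0 /beta_coef opprB.
Qed.

Let num : set (xG Y) := set_mul (range (xmu Y)) (commutator_subgroup [set: xG Y] setT).

Lemma num_normal : normal num.
Proof.
apply: set_mul_normal; first exact: image_mu_normal.
by apply: commutator_normal; exact: setT_normal.
Qed.

Lemma num_comm x y : num [~ x, y]%g.
Proof.
apply: set_mul_supr; first by exists 1%g => //; rewrite gmulf1.
by apply: gen_in; exists x => //; exists y.
Qed.

(** The projection to the abelian group [G / mu(H) [G, G]] extends to chains of bidegree [(0, 1)].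
    It kills vertical boundaries, being multiplicative, and horizontal ones, because the two faces
    of [(h, g)] differ by [mu h]. *)
Lemma beta_boundary_num a v : tot_d v = beta a -> num a.
Proof.
pose V := abq num_normal num_comm; pose pi : xG Y -> V := @abq_pi _ _ num_normal num_comm.
have piM x y : pi (x * y)%g = pi x + pi y by exact: abq_piM.
have pi1 : pi 1%g = 0 by apply/abq_pi_eq0; case: num_normal => -[].
have lam_act g (t : 2.-tuple G) : pi (nth 1%g (bar_act g t) 1) = pi (nth 1%g t 1).
  by rewrite nth_bar_act.
pose lam : {additive bar_coinv G 1 -> V} := coinv_lift lam_act.
have lam1 x : lam (cls1 x) = pi x by exact: coinv_liftE.
have lam_v w : lam (coinv_d w) = 0.
  elim/coinv_ind: w => [t||x y gx gy]; [|by rewrite [coinv_d 0]raddf0 /= raddf0|].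
    rewrite cls_normalize; set u := bar_act _ t.
    have -> : u = [tuple 1%g; nth 1%g t 1; nth 1%g t 2].
      by apply: eq_bar_tuple => -[|[|[|j]]] // _; rewrite nth_bar_act //= mulVg.
    rewrite -/(cls2 _ _) coinv_dcls2 raddfD raddfB /= !lam1 piM.
    by rewrite opprD addrCA subrr addr0 addNr.
  by rewrite coinv_dB raddfB /= gx gy subrr.
have lam_h (w : ner_bar Y 1 1) : lam (ner_bar_h w) = 0.
  elim/coinv_ind: w => [t||x y gx gy]; [|by rewrite [ner_bar_h 0]raddf0 /= raddf0|]; last first.
    by rewrite !raddfB /= gx gy subrr.
  rewrite cls1E /ner_bar_h /alt_sum !big_ord_recl !big_ord0 addr0 /=.
  rewrite mulr1z mulrN1z !coinv_map_csmap !csmap_cls1 raddfB /= !lam1.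
  case: (nth 1%g t 1) => h g; rewrite [X in _ - pi X](_ : _ = xmu Y h * g)%g //.
  rewrite [X in pi X - _](_ : _ = g) // piM opprD addrCA subrr addr0.
  apply/eqP; rewrite oppr_eq0; apply/eqP/abq_pi_eq0.
  by apply: set_mul_supl; [exact: gen_1|exists h].
move=> /(congr1 (fun z : bifamily C => lam (z 0%N 1%N))).
rewrite /tot_d raddfD raddfMz /= lam_h lam_v mul0rz addr0 /beta singleE.
rewrite raddfB /= !lam1 pi1 subr0 => /esym.
by move/abq_pi_eq0.
Qed.

(** The chains of this form are closed under differences by [d_beta2], so only generators of
    bidegrees [(0, 1)] and [(1, 0)] matter. *)
Lemma degree1_beta u : in_degree 1 u ->
  exists y v, in_degree 2 v /\ u = beta y + tot_d v.
Proof.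
move=> u1; pose R (u : bifamily C) := exists y v, in_degree 2 v /\ u = beta y + tot_d v.
have R0 : R 0 by exists 1%g, 0; split=> //; rewrite beta1 raddf0 addr0.
have RB x y : R x -> R y -> R (x - y).
  move=> [a [v [v2 ->]]] [b [w [w2 ->]]].
  exists (a * b^-1)%g, (v - w - beta2 (a * b^-1)%g b); split.
    by do 2?apply: in_degreeB => //; exact: beta2_degree.
  rewrite [tot_d (_ - _)]raddfB /= d_beta2 mulgVK raddfB /=.
  exact: subrDD_cancel.
(* The class of [1] removed by [beta] is itself the boundary of [cls2 1 1]. *)
have R01 x : R (@single C 0 1 x).
  elim/coinv_ind: x => [t||x y Rx Ry]; [|by rewrite raddf0|by rewrite raddfB; exact: RB].
  exists (nth 1%g t 1), (@single C 0 2 (cls2 1%g 1%g)); split; first exact: single_degree.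
  rewrite tot_d_single0 -raddfD /= cls1E; congr single.
  by rewrite -[ner_bar_v _]/(coinv_d _) coinv_dcls2 mulg1 subrr add0r /beta_coef subrK.
(* Modulo the action there is only one generator. It bounds, since the three faces of the generator
   of bidegree [(2, 0)] have signs adding up to 1. *)
have R10 x : R (@single C 1 0 x).
  elim/coinv_ind: x => [t||x y Rx Ry]; [|by rewrite raddf0|by rewrite raddfB; exact: RB].
  exists 1%g, (@single C 2 0 (cls [tuple 1%g])); split; first exact: single_degree.
  rewrite beta1 add0r tot_d_singleS0; congr single.
  rewrite cls_normalize [RHS]/(ner_bar_h _) /ner_bar_h /alt_sum !big_ord_recl big_ord0 addr0.
  rewrite /bump /= !exprS expr0 !mulr1 mulrN1 opprK !mulr1z mulrN1z.
  rewrite !coinv_map_csmap !csmapE.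
  have E i : map_tuple (@ner_face Y 1 i) [tuple 1%g] = [tuple 1%g].
    by apply: val_inj; rewrite /= gmulf1.
  rewrite !E addrA subrr add0r; congr cls.
  by apply: eq_bar_tuple => -[|j] // _; rewrite nth_bar_act //= mulVg.
have -> : u = single (u 0%N 1%N) + single (u 1%N 0%N).
  apply: bifamily_ext => p q.
  rewrite -[RHS]/(single (u 0%N 1%N) p q + single (u 1%N 0%N) p q).
  have [[<- <-]|n01] := eqVneq (0%N, 1%N) (p, q).
    by rewrite singleE single_neq ?addr0.
  have [[<- <-]|n10] := eqVneq (1%N, 0%N) (p, q).
    by rewrite singleE single_neq ?add0r.
  rewrite !single_neq // addr0; apply: u1.
  by case: p q n01 n10 => [|[|p]] [|[|q]].
rewrite -[single (u 1%N 0%N)]opprK -[- single (u 1%N 0%N)]sub0r.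
by apply: (RB) => //; exact: RB.
Qed.

End LowDegree.

(** * Chains killed by faces *)

Section ThomFunctor.
Variables W Y Z : xmod.

Lemma thom_comp (g : xmod_hom Y Z) (f : xmod_hom W Y) x :
  thom (xmod_comp g f) x = thom g (thom f x).
Proof. by rewrite /thom tmap_comp. Qed.

Lemma thom_ext (f g : xmod_hom Y Z) : xeq f g -> thom f =1 thom g.
Proof. by case=> fg_rho fg_tau; exact: tmap_ext. Qed.

Lemma thom_id x : thom (xmod_id Y) x = x.
Proof. exact: tmap_id. Qed.

Lemma thomD (f : xmod_hom Y Z) x y : thom f (x + y) = thom f x + thom f y.
Proof. exact: raddfD. Qed.

Lemma thomB (f : xmod_hom Y Z) x y : thom f (x - y) = thom f x - thom f y.
Proof. exact: raddfB. Qed.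

Lemma tot_dD (C : bicomplex) (x y : bifamily C) : tot_d (x + y) = tot_d x + tot_d y.
Proof. exact: raddfD. Qed.

Lemma tot_dB (C : bicomplex) (x y : bifamily C) : tot_d (x - y) = tot_d x - tot_d y.
Proof. exact: raddfB. Qed.

Lemma thom_beta (f : xmod_hom Y Z) a : thom f (beta a) = beta (tau f a).
Proof.
rewrite /thom /beta tmap_single /beta_coef raddfB /=.
by rewrite !(csmap_cls1 (tau f)) gmulf1.
Qed.

Lemma thom_beta2 (f : xmod_hom Y Z) a b :
  thom f (beta2 a b) = beta2 (tau f a) (tau f b).
Proof.
rewrite /thom /beta2 tmap_single /beta2_coef !raddfB /=.
by rewrite !(csmap_cls2 (tau f)) !gmulf1.
Qed.

Lemma thom_beta_mu (f : xmod_hom Y Z) r : thom f (beta_mu r) = beta_mu (rho f r).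
Proof.
rewrite /thom /beta_mu tmap_single raddfB /= !(csmap_cls1 (@ner_map _ _ f 1)) gmulf1.
by rewrite /ner_map /= gmulf1.
Qed.
End ThomFunctor.

Lemma addr_cancel6 (V : zmodType) (c u w x y : V) :
  u + c - w + (y + x - u) - (x + y - w) = c.
Proof.
rewrite opprB -addrA [_ + (w - _)]addrC [y + x]addrC [w - _ + _]addrA subrK.
by rewrite addrA subrK [u + c]addrC addrK.
Qed.

Lemma addr_cancel_beta (V : zmodType) (p q b c : V) :
  p + q + (c + b - (p + (b + q))) = c.
Proof.
by rewrite [b + q]addrC [p + (q + b)]addrA [- _]opprD [c + b + _]addrACA subrr addr0 [LHS]addrC subrK.
Qed.

Section KilledByFaces.
Variables (Y Z : xmod) (n : nat) (d : 'I_n -> xmod_hom Y Z).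

Definition killed (x : bifamily (xmod_bicomplex Y)) : Prop := forall i, thom (d i) x = 0.
Definition killedG (a : xG Y) : Prop := forall i, tau (d i) a = 1%g.

Lemma killedB x y : killed x -> killed y -> killed (x - y).
Proof. by move=> xk yk i; rewrite raddfB /= xk yk subrr. Qed.

Lemma killedD x y : killed x -> killed y -> killed (x + y).
Proof. by move=> xk yk i; rewrite raddfD /= xk yk addr0. Qed.

Lemma killed0 : killed 0.
Proof. by move=> i; rewrite raddf0. Qed.

Lemma killed_d x : killed x -> killed (tot_d x).
Proof. by move=> xk i; rewrite thom_d xk raddf0. Qed.

Lemma killed_beta a : killedG a -> killed (beta a).
Proof. by move=> ak i; rewrite thom_beta ak beta1. Qed.

Lemma killed_beta2 a b :
  (forall i, tau (d i) a = 1%g \/ tau (d i) b = 1%g) -> killed (beta2 a b).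
Proof. by move=> ab i; rewrite thom_beta2; case: (ab i) => ->; rewrite ?beta21 ?beta2_1. Qed.

Definition beta_bounds (a : xG Y) : Prop :=
  killedG a /\ exists v, [/\ in_degree 2 v, killed v & tot_d v = beta a].

Lemma beta_boundsM a b : beta_bounds a -> beta_bounds b -> beta_bounds (a * b)%g.
Proof.
move=> [ak [v [v2 vk dv]]] [bk [w [w2 wk dw]]]; split.
  by move=> i; rewrite gmulfM ak bk mulg1.
exists (v + w - beta2 a b); split.
- by apply: in_degreeB; [exact: in_degreeD|exact: beta2_degree].
- by apply: killedB; [exact: killedD|apply: killed_beta2 => i; left].
- by rewrite raddfB raddfD /= dv dw betaM.
Qed.

Lemma beta_boundsV a : beta_bounds a -> beta_bounds a^-1%g.
Proof.
move=> [ak [v [v2 vk dv]]]; have ak' : killedG a^-1%g.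
  by move=> i; rewrite gmulfV ak invg1.
split=> //; exists (beta2 a^-1%g a - v); split.
- by apply: in_degreeB => //; exact: beta2_degree.
- by apply: killedB => //; apply: killed_beta2 => i; left.
- by rewrite raddfB /= dv d_beta2 mulVg beta1 subr0 addrK.
Qed.

Lemma beta_bounds_subgroup : subgroup beta_bounds.
Proof.
split; [|exact: beta_boundsM|exact: beta_boundsV].
split; first by move=> i; rewrite gmulf1.
by exists 0; split; [|exact: killed0|rewrite raddf0 beta1].
Qed.

Lemma beta_bounds_mu r : (forall i, rho (d i) r = 1%g) -> beta_bounds (xmu Y r).
Proof.
move=> rk; split; first by move=> i; rewrite tau_mu rk gmulf1.
exists (0 - beta_mu r); split.
- by apply: in_degreeB => //; exact: beta_mu_degree.
- by apply: killedB; [exact: killed0|move=> i; rewrite thom_beta_mu rk beta_mu1].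
- by rewrite sub0r raddfN /= d_beta_mu opprK.
Qed.

(** The bounding chain comes from [b a [a, b] = a b]. Each of its three terms is killed by a face
    that kills [a] or [b]. *)
Lemma beta_bounds_comm a b :
  (forall i, tau (d i) a = 1%g \/ tau (d i) b = 1%g) -> beta_bounds [~ a, b]%g.
Proof.
move=> ab; have ck : killedG [~ a, b]%g.
  by move=> i; rewrite gmulfR; case: (ab i) => ->; rewrite ?comm1g ?commg1.
split=> //; exists (beta2 (b * a)%g [~ a, b]%g + beta2 b a - beta2 a b); split.
- by apply: in_degreeB; [apply: in_degreeD|]; exact: beta2_degree.
- apply: killedB; last exact: killed_beta2.
  by apply: killedD; apply: killed_beta2 => i; [right|case: (ab i); [right|left]].
rewrite raddfB raddfD /= !d_beta2 -commgC.
exact: addr_cancel6.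
Qed.
End KilledByFaces.

Section Refine.
Variables (Y Z : xmod) (n : nat) (d : 'I_n -> xmod_hom Y Z).
Hypothesis split_d : split_faces d.
Local Notation T Y := (bifamily (xmod_bicomplex Y)).

(** Subtract [s d_i y] for [i] descending. This has boundary [s d_i (tot_d y) = 0], makes [d_i]
    vanish, and preserves vanishing under [d_j] for [j > i] because [d_j s d_i = g d_j]. *)
Lemma refine_chain k (y : T Y) : in_degree k y -> killed d (tot_d y) ->
  exists y', [/\ in_degree k y', killed d y' & tot_d y' = tot_d y].
Proof.
move=> yk dyk.
suff: forall t, (t <= n)%N -> exists y' : T Y, [/\ in_degree k y', tot_d y' = tot_d y &
    forall i : 'I_n, (n - t <= i)%N -> thom (d i) y' = 0].
  case/(_ n (leqnn n)) => y' [y'k dy' y'0]; exists y'; split=> // i.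
  by apply: y'0; rewrite subnn.
elim=> [_|t IHt lt_tn].
  by exists y; split=> // i; rewrite subn0 leqNgt ltn_ord.
have [y' [y'k dy' y'0]] := IHt (ltnW lt_tn).
have lt_i : (n - t.+1 < n)%N by lia.
pose i := Ordinal lt_i; have [s [ds sg]] := split_d i.
have ds1 x : thom (d i) (thom s x) = x by rewrite -thom_comp (thom_ext ds) thom_id.
exists (y' - thom s (thom (d i) y')); split.
- by apply: in_degreeB => //; do 2!apply: thom_degree.
- by rewrite raddfB /= -!thom_d dy' dyk raddf0 subr0.
move=> j; rewrite leq_eqVlt => /orP[/eqP ij|lt_ij].
  have <- : i = j by exact: val_inj.
  by rewrite raddfB /= ds1 subrr.
have [g dg] := sg j lt_ij; have y'j : thom (d j) y' = 0 by apply: y'0; move: lt_ij => /=; lia.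
have := thom_ext dg y'; rewrite !thom_comp y'j raddf0 => dsd.
by rewrite raddfB /= y'j dsd subrr.
Qed.

(** The same descent, performed on [y] in the group and on [v] in the complex. *)
Lemma refine_beta (u : T Y) : in_degree 1 u -> killed d u ->
  exists y v, [/\ killedG d y, in_degree 2 v, killed d v & u = beta y + tot_d v].
Proof.
move=> u1 uk.
suff: forall t, (t <= n)%N -> exists y (v : T Y), [/\ in_degree 2 v, u = beta y + tot_d v &
    forall i : 'I_n, (n - t <= i)%N -> tau (d i) y = 1%g /\ thom (d i) v = 0].
  case/(_ n (leqnn n)) => y [v [v2 uE yv]]; exists y, v.
  by split=> // i; case: (yv i); rewrite ?subnn.
elim=> [_|t IHt lt_tn].
  have [y [v [v2 uE]]] := degree1_beta u1.
  by exists y, v; split=> // i; rewrite subn0 leqNgt ltn_ord.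
have [y [v [v2 uE yv]]] := IHt (ltnW lt_tn).
have lt_i : (n - t.+1 < n)%N by lia.
pose i := Ordinal lt_i; have [s [ds sg]] := split_d i.
have ds1 x : thom (d i) (thom s x) = x by rewrite -thom_comp (thom_ext ds) thom_id.
pose e y := tau s (tau (d i) y); pose y' := (y * (e y)^-1)%g.
have y'E : y = (y' * e y)%g by rewrite mulgVK.
(* The term [beta2] accounts for the failure of [beta] to be additive on [y = y' * e y]; faces of
   index at least [i] kill [y'] or [e y], hence this term. *)
exists y', (v - thom s (thom (d i) v) - beta2 y' (e y)); split.
- apply: in_degreeB; last exact: beta2_degree.
  by apply: in_degreeB => //; do 2!apply: thom_degree.
- rewrite !tot_dB d_beta2 -y'E -!thom_d.
  have : thom s (thom (d i) u) = 0 by rewrite uk raddf0.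
  rewrite uE !thomD !thom_beta -/(e y) => E.
  rewrite -[LHS]subr0 -E; exact: subrDD_cancel.
move=> j; rewrite leq_eqVlt => /orP[/eqP ij|lt_ij].
  have <- : i = j by exact: val_inj.
  have y'1 : tau (d i) y' = 1%g.
    by rewrite gmulfM gmulfV /e; have [_ dsT] := ds; rewrite [tau (d i) (tau s _)]dsT mulgV.
  by split=> //; rewrite !thomB ds1 subrr thom_beta2 y'1 beta2_1 subrr.
have [g dg] := sg j lt_ij.
have [yj vj] : tau (d j) y = 1%g /\ thom (d j) v = 0 by apply: yv; move: lt_ij => /=; lia.
have eyj : tau (d j) (e y) = 1%g.
  by have [_ E] := dg; rewrite [LHS]E /= yj gmulf1.
split; first by rewrite gmulfM gmulfV yj eyj mulgV.
have := thom_ext dg v; rewrite !thom_comp vj raddf0 => dsd.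
by rewrite !raddfB /= vj dsd thom_beta2 eyj beta21 !subr0.
Qed.
End Refine.

(** * Dimension shifting along the resolution *)

(* An isomorphism between the subquotients [ZA / BA] and [ZB / BB], given as a relation. *)
Record zcorr (A B : zmodType) (ZA BA : A -> Prop) (ZB BB : B -> Prop)
    (R : A -> B -> Prop) : Prop := ZCorr {
  zcorr_total : forall a, ZA a -> exists b, R a b;
  zcorr_cycle : forall a b, ZA a -> R a b -> ZB b;
  zcorr_surj : forall b, ZB b -> exists2 a, ZA a & R a b;
  zcorr_bound : forall a b, ZA a -> R a b -> (BA a <-> BB b);
  zcorrB : forall a b a' b', R a b -> R a' b' -> R (a - a') (b - b') }.

Lemma zcorr_refl (A : zmodType) (ZA BA : A -> Prop) : zcorr ZA BA ZA BA eq.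
Proof.
split=> [a _|a b Za <-|b Zb|a b _ <-|a b a' b' <- <-] //; first by exists a.
by exists b.
Qed.

Lemma zcorr_trans (A B C : zmodType) (ZA BA : A -> Prop) (ZB BB : B -> Prop)
    (ZC BC : C -> Prop) R S :
  zcorr ZA BA ZB BB R -> zcorr ZB BB ZC BC S ->
  zcorr ZA BA ZC BC (fun a c => exists2 b, R a b & S b c).
Proof.
move=> rP sP; split=> [a Za|a c Za [b Rab Sbc]|c Zc|a c Za [b Rab Sbc]|a c a' c' [b Rab Sbc] [b' Rab' Sbc']].
- have [b Rab] := zcorr_total rP Za.
  by have [c Sbc] := zcorr_total sP (zcorr_cycle rP Za Rab); exists c, b.
- exact: (zcorr_cycle sP (zcorr_cycle rP Za Rab) Sbc).
- have [b Zb Sbc] := zcorr_surj sP Zc; have [a Za Rab] := zcorr_surj rP Zb.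
  by exists a => //; exists b.
- by rewrite (zcorr_bound rP Za Rab); exact: (zcorr_bound sP (zcorr_cycle rP Za Rab) Sbc).
- by exists (b - b'); [exact: (zcorrB rP Rab Rab')|exact: (zcorrB sP Sbc Sbc')].
Qed.

Lemma hopf_den_map (Y Z Y' Z' : xmod) n (d : 'I_n -> xmod_hom Y Z)
    (d' : 'I_n -> xmod_hom Y' Z') (f : xmod_hom Y Y') (g : xmod_hom Z Z') :
  (forall i, xeq (xmod_comp (d' i) f) (xmod_comp g (d i))) ->
  forall y, hopf_den d y -> hopf_den d' (tau f y).
Proof.
move=> fg; have [sD' _] := hopf_den_normal d'; have [D1 DM DV] := sD'.
have sP : subgroup [set y | hopf_den d' (tau f y)].
  split=> /= [|x y Dx Dy|x Dx]; rewrite ?gmulf1 ?gmulfM ?gmulfV //; first exact: DM.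
  exact: DV.
have kG i y : kerG d i y -> kerG d' i (tau f y).
  by move=> dy; rewrite /kerG /= [LHS](fg i).2 /= dy gmulf1.
have cN (I : {set 'I_n}) : normal (commutator_subgroup (capG d' I) (capG d' (~: I))).
  by apply: commutator_normal; exact: capG_normal.
have muN : normal (xmu Y' @` \bigcap_(i in [set: 'I_n]) kerH d' i).
  apply: image_mu_normal; first split.
  - by move=> i _; exact: gmulf1.
  - by move=> r s dr ds i _; rewrite /kerH /= gmulfM dr // ds // mulg1.
  - by move=> r dr i _; rewrite /kerH /= gmulfV dr // invg1.
  - by move=> a r dr i _; rewrite /kerH /= rho_act dr // gactr1.
apply: (set_mul_sub sP) => [_ [r dr <-]|] /=.
  rewrite tau_mu; apply: set_mul_supl; first by case: (big_set_mul_normal cN) => -[].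
  exists (rho f r) => // i _.
  by rewrite /kerH /= [LHS](fg i).1 /= dr // gmulf1.
apply: (big_set_mul_sub sP) => I; apply: (gen_sub sP) => _ [a Ia [b Ib <-]] /=.
apply: set_mul_supr; first by case: muN => -[].
apply: (big_set_mul_sup (i := I)); first by move=> J; case: (cN J) => -[].
rewrite gmulfR; apply: gen_in; exists (tau f a); first by move=> i iI; apply: kG; exact: Ia.
by exists (tau f b) => // i iI; apply: kG; exact: Ib.
Qed.

Section Resolution.
Variable X : xmod.
Local Notation P k := (cotriple_iter k X).
Local Notation face k i := (cotriple_face k i X).
Local Notation T k := (bifamily (xmod_bicomplex (P k))).

(** [P k] is the iterate [P^k]: so [P 0] is [X], and the degree [k] term of the resolution is
    [P k.+1]. *)
Definition all_faces k (i : 'I_k.+1) := face k i.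
Definition up_faces k (i : 'I_k) := face k i.+1.
Arguments all_faces : clear implicits.
Arguments up_faces : clear implicits.

(** A contraction for the faces only: it does not commute with [tot_d] in general, and this defect
    produces the connecting maps. *)
Definition tsec k : T k -> T k.+1 := tmap (@secH (P k)) (@secG (P k)).
HB.instance Definition _ k := GRing.Additive.on (@tsec k).

Lemma tsec_degree k m x : in_degree m x -> in_degree m (@tsec k x).
Proof. exact: tmap_degree. Qed.

Lemma face0_tsec k x : thom (face k 0) (@tsec k x) = x.
Proof.
rewrite /tsec /thom tmap_comp cotriple_face0 -[RHS]tmap_id.
by apply: tmap_ext; [exact: secHK|exact: secGK].
Qed.

Lemma faceS_tsec k i x : thom (face k.+1 i.+1) (@tsec k.+1 x) = tsec (thom (face k i) x).
Proof.
rewrite /tsec /thom !tmap_comp cotriple_faceS.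
by apply: tmap_ext; [exact: secH_natural|exact: secG_natural].
Qed.

Lemma face_face0 k i (x : T k.+2) :
  thom (face k i) (thom (face k.+1 0) x) = thom (face k 0) (thom (face k.+1 i.+1) x).
Proof. by rewrite -!thom_comp; apply: thom_ext; exact: cotriple_face_face0. Qed.

Lemma tau_face_face0 k i x :
  tau (face k i) (tau (face k.+1 0) x) = tau (face k 0) (tau (face k.+1 i.+1) x).
Proof. exact: (cotriple_face_face0 X k i).2. Qed.

Definition face_cycle k : T k -> Prop :=
  match k with
  | 0 => fun _ => True
  | k'.+1 => killed (all_faces k')
  end.

Lemma face_cycle_tsec k x : face_cycle x -> killed (up_faces k) (@tsec k x).
Proof.
case: k x => [|k] x xk i; first by case: i.
by rewrite /up_faces faceS_tsec xk raddf0.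
Qed.

Lemma face_cycle_face0 k (x : T k.+1) : killed (up_faces k) x ->
  face_cycle (thom (face k 0) x).
Proof.
case: k x => [//|k] x xk i; rewrite /all_faces face_face0.
by rewrite [thom (face k.+1 i.+1) x]xk raddf0.
Qed.

Lemma face_cycleS k (x : T k.+1) :
  @face_cycle k.+1 x <-> killed (up_faces k) x /\ thom (face k 0) x = 0.
Proof.
split=> [xk|[xk x0] [[|i] lt_i]]; [split|exact: x0|].
- by move=> i; exact: (xk (Ordinal (ltn_ord i : (i.+1 < k.+1)%N))).
- exact: (xk ord0).
- exact: (xk (Ordinal (lt_i : (i < k)%N))).
Qed.

Lemma face_cycleB k x y : @face_cycle k x -> @face_cycle k y -> @face_cycle k (x - y).
Proof. by case: k x y => [//|k] x y; exact: killedB. Qed.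

(* [T(P_k)] has homology in degree 1, so there boundaries take the place of cycles. *)
Definition res_cycle k m (x : T k) : Prop :=
  [/\ in_degree m x, face_cycle x, tot_d x = 0 &
    m = 1%N -> exists2 v, in_degree 2 v & tot_d v = x].

Definition res_bound k m (x : T k) : Prop :=
  exists y, [/\ in_degree m.+1 y, face_cycle y & tot_d y = x].

Lemma res_boundB k m (x y : T k) : res_bound m x -> res_bound m y -> res_bound m (x - y).
Proof.
move=> [u [um uk <-]] [v [vm vk <-]]; exists (u - v); split; rewrite ?tot_dB //.
  exact: in_degreeB.
exact: face_cycleB.
Qed.

(** The connecting map of the short exact sequence given by [d_0] from the chains killed by the
    upper faces onto [face_cycle]: lift [z], then take the boundary. *)
Definition res_step k m (z : T k) (w : T k.+1) : Prop :=
  exists x, [/\ in_degree m x, killed (up_faces k) x, thom (face k 0) x = z & tot_d x = w].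

(** Exactness of the middle complex: [w] bounds in [T(P^(k+1))], and the bounding chain can be
    refined because the upper faces are split. *)
Lemma res_exact k m (w : T k.+1) : killed (up_faces k) w ->
  in_degree m.+1 w -> tot_d w = 0 ->
  (m.+1 = 1%N -> exists2 v, in_degree 2 v & tot_d v = w) ->
  exists x, [/\ in_degree m.+2 x, killed (up_faces k) x & tot_d x = w].
Proof.
move=> wk wm dw w1.
have [v vm dv] : exists2 v, in_degree m.+2 v & tot_d v = w.
  by case: m wm w1 => [|m] wm w1; [exact: w1|exact: free_xmod_tot_exact].
have [|x [xm xk dx]] := refine_chain (cotriple_split_faces X (k := k)) vm; first by rewrite dv.
by exists x; rewrite dx dv.
Qed.

Lemma res_step_corr k m : zcorr (@res_cycle k m.+2) (res_bound m.+2)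
  (@res_cycle k.+1 m.+1) (res_bound m.+1) (@res_step k m.+2).
Proof.
split.
- move=> z [zm zk dz _]; exists (tot_d (tsec z)), (tsec z).
  by split; [exact: tsec_degree|exact: face_cycle_tsec|exact: face0_tsec|].
- move=> z w [zm zk dz _] [x [xm xk x0 <-]]; split.
  + exact: tot_d_degree.
  + by apply/face_cycleS; split; [exact: killed_d|rewrite thom_d x0 dz].
  + exact: tot_dK.
  + by case=> m0; rewrite m0 in xm; exists x.
- move=> w [wm /face_cycleS[wk w0] dw w1].
  have [x [xm xk dx]] := res_exact wk wm dw w1.
  exists (thom (face k 0) x); last by exists x.
  split=> //; [exact: thom_degree|exact: face_cycle_face0|].
  by rewrite -thom_d dx.
- move=> z w [zm zk dz _] [x [xm xk x0 dx]]; split.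
    move=> [z' [z'm z'k dz']].
    (* If [z] bounds [z'], lifting [z'] by [tsec] corrects the lift [x] into the kernel of [d_0],
       with the same boundary [w]. *)
    exists (x - tot_d (tsec z')); split.
    + by apply: in_degreeB => //; apply: tot_d_degree; exact: tsec_degree.
    + apply/face_cycleS; split.
        by apply: killedB => //; apply: killed_d; exact: face_cycle_tsec.
      by rewrite thomB thom_d face0_tsec dz' x0 subrr.
    + by rewrite tot_dB tot_dK subr0.
  move=> [w' [w'm /face_cycleS[w'k w'0] dw']].
  (* Conversely [x - w'] is a cycle of the middle complex; it bounds some [y], and [d_0 y] has
     boundary [z]. *)
  have [||||y [ym yk dy]] := @res_exact k m.+1 (x - w') => //.
  + exact: killedB.
  + exact: in_degreeB.
  + by rewrite tot_dB dx dw' subrr.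
  exists (thom (face k 0) y); split.
  + exact: thom_degree.
  + exact: face_cycle_face0.
  + by rewrite -thom_d dy thomB x0 w'0 subr0.
- move=> z w z' w' [x [xm xk x0 dx]] [x' [x'm x'k x'0 dx']].
  exists (x - x'); split; rewrite ?thomB ?tot_dB ?x0 ?x'0 ?dx ?dx' //.
    exact: in_degreeB.
  exact: killedB.
Qed.

Lemma res_corr k m : exists R, zcorr (@res_cycle 0 (m.+1 + k)) (res_bound (m.+1 + k))
  (@res_cycle k m.+1) (res_bound m.+1) R.
Proof.
elim: k m => [|k IHk] m; first by exists eq; rewrite addn0; exact: zcorr_refl.
have [R RP] := IHk m.+1; rewrite -addSnnS.
by exists (fun a c => exists2 b, R a b & res_step m.+2 b c); exact: (zcorr_trans RP (res_step_corr k m)).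
Qed.

Lemma res_cycle_beta k (x : xG (P k.+1)) : hopf_num (all_faces k) x ->
  res_cycle 1 (beta x : T k.+1).
Proof.
move=> [Rx Kx].
have [v v2 dv] : exists2 v : T k.+1, in_degree 2 v & tot_d v = beta x.
  (* For an empty family of faces, [beta_bounds] just says that [beta x] is a boundary. *)
  pose d0 (i : 'I_0) := face k 0.
  suff [_ [v [v2 _ dv]]] : beta_bounds d0 x by exists v.
  have sB := beta_bounds_subgroup d0.
  apply: (set_mul_sub sB) Rx; first by move=> _ [r _ <-]; apply: beta_bounds_mu => -[].
  by apply: (gen_sub sB) => _ [a _ [b _ <-]]; apply: beta_bounds_comm => -[].
split; first exact: beta_degree.
- by apply: killed_beta => i; exact: Kx.
- by rewrite -dv tot_dK.
- by exists v.
Qed.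

Lemma res_bound_betaM k (x y : xG (P k.+1)) :
  killedG (all_faces k) x -> res_bound 1 (beta x + beta y - beta (x * y)%g : T k.+1).
Proof.
move=> xk; exists (beta2 x y); split; [exact: beta2_degree| |exact: d_beta2].
by apply: killed_beta2 => i; left.
Qed.

(** Lift [w] by [tsec], refine the lift along the split upper faces, and apply [d_0]. *)
Lemma refine_beta_sec k (w : T k) : in_degree 1 w -> face_cycle w ->
  exists y v, [/\ killedG (up_faces k) y, in_degree 2 v, killed (up_faces k) v &
    w = beta (tau (face k 0) y) + tot_d (thom (face k 0) v)].
Proof.
move=> w1 wk.
have [y [v [yk v2 vk E]]] := refine_beta (cotriple_split_faces X (k := k))
  (tsec_degree w1) (face_cycle_tsec wk).
exists y, v; split=> //.
by rewrite -thom_d -thom_beta -thomD -E face0_tsec.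
Qed.

Lemma killedG_face0 k y : killedG (up_faces k.+1) y ->
  killedG (all_faces k) (tau (face k.+1 0) y).
Proof.
move=> yk i; rewrite /all_faces tau_face_face0.
by rewrite [tau (face k.+1 i.+1) y]yk gmulf1.
Qed.

(** Since [w] bounds, so does [beta x], which places [x] in [mu(H) [G, G]]. *)
Lemma res_cycle_beta_surj k (w : T k.+1) : res_cycle 1 w ->
  exists2 x, hopf_num (all_faces k) x & res_bound 1 (w - beta x).
Proof.
move=> [w1 wk dw /(_ erefl)[v0 v02 dv0]].
have [y [v [yk v2 vk E]]] := refine_beta_sec w1 wk.
set x := tau _ y in E; exists x.
  split; last by move=> i _; exact: killedG_face0.
  apply: (@beta_boundary_num _ _ (v0 - thom (face k.+1 0) v)).
  by rewrite tot_dB dv0 {1}E addrK.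
exists (thom (face k.+1 0) v); split; [exact: thom_degree|exact: face_cycle_face0|].
by rewrite E addrC addKr.
Qed.

Lemma hopf_den_beta k (x : xG (P k.+1)) : hopf_den (all_faces k) x ->
  res_bound 1 (beta x : T k.+1).
Proof.
move=> Dx; suff [_ [v [v2 vk dv]]] : beta_bounds (all_faces k) x by exists v.
have sB := beta_bounds_subgroup (all_faces k).
apply: (set_mul_sub sB) Dx.
  by move=> _ [r dr <-]; apply: beta_bounds_mu => i; exact: dr.
apply: (big_set_mul_sub sB) => I; apply: (gen_sub sB) => _ [a Ia [b Ib <-]].
apply: beta_bounds_comm => i; have [iI|iI] := boolP (i \in I); [left; exact: Ia|right].
by apply: Ib; rewrite /= inE.
Qed.

(** It suffices to lift [x] along [d_0] to the numerator for the upper faces, which equals the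
    denominator; then [d_0] carries denominator to denominator. *)
Lemma beta_hopf_den k (x : xG (P k.+1)) : killedG (all_faces k) x ->
  res_bound 1 (beta x : T k.+1) -> hopf_den (all_faces k) x.
Proof.
move=> xk [v [v2 vk dv]].
(* [secG] does not preserve [1]; dividing by [o] makes the upper faces kill the lift. *)
pose o := secG (1%g : xG (P k.+1)); pose y := (secG x * o^-1)%g.
have yk : killedG (up_faces k.+1) y.
  move=> i; rewrite /up_faces cotriple_faceS gmulfM gmulfV !secG_natural gmulf1.
  by rewrite [tau (face k i) x]xk mulgV.
have d0y : tau (face k.+1 0) y = x.
  by rewrite cotriple_face0 gmulfM gmulfV !secGK invg1 mulg1.
(* All faces kill [t], so up to a boundary it is [beta z] with [z] killed by all faces. Dividing [y]
   by [z] preserves [d_0 y = x] and makes [beta] of the lift a boundary. *)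
pose t : T k.+2 := beta y - tot_d (tsec v).
have t1 : in_degree 1 t.
  by apply: in_degreeB; [exact: beta_degree|apply: tot_d_degree; exact: tsec_degree].
have tk : @face_cycle k.+2 t.
  apply/face_cycleS; split.
    by apply: killedB; [exact: killed_beta|apply: killed_d; exact: face_cycle_tsec].
  by rewrite thomB thom_beta thom_d d0y face0_tsec dv subrr.
have [y2 [v3 [y2k v32 v3k tE]]] := refine_beta_sec t1 tk.
set z := tau _ y2 in tE; pose y3 := (y * z^-1)%g.
have zk : killedG (all_faces k.+1) z by exact: killedG_face0.
have y3k : killedG (up_faces k.+1) y3.
  move=> i; rewrite gmulfM gmulfV yk.
  by rewrite [tau _ z](zk (Ordinal (ltn_ord i : (i.+1 < k.+2)%N))) mulgV.
have y3D : hopf_den (up_faces k.+1) y3.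
  apply: (hopf_num_sub_den (cotriple_split_faces X (k := k.+1))).
  split; last by move=> i _; exact: y3k.
  apply: (@beta_boundary_num _ _ (tsec v + thom (face k.+2 0) v3 + beta2 y3 z)).
  rewrite !tot_dD d_beta2 mulgVK.
  have -> : beta y = tot_d (tsec v) + t by rewrite addrC subrK.
  by rewrite tE; exact: addr_cancel_beta.
have -> : x = tau (face k.+1 0) y3.
  rewrite gmulfM gmulfV d0y.
  by rewrite [tau _ z](zk ord0) invg1 mulg1.
by apply: hopf_den_map y3D => i; exact: cotriple_face_face0.
Qed.
End Resolution.

Arguments all_faces : clear implicits.

(** * The isomorphism between the quotient and homology *)

Section HopfToHomology.
Local Open Scope quotient_scope.
Variables (X : xmod) (k : nat).
Local Notation C := (xmod_bicomplex X).
Local Notation N := (subgroup_type (proj1 (hopf_num_normal (all_faces X k)))).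
Local Notation hopf_pi := (\pi_(xmod_hopf X k) : N -> xmod_hopf X k).
Local Notation homology_pi :=
  (\pi_(Quotient.quot (@tot_boundary C k.+2)) : tot_cycle C k.+2 -> xmod_homology X k.+2).

Lemma hopf_piP (x y : N) :
  hopf_pi x = hopf_pi y <-> hopf_den (all_faces X k) ((val x)^-1 * val y)%g.
Proof.
rewrite -gmulfV -gmulfM; split=> [/quotg_piP/asboolP//|Dxy].
by apply/quotg_piP; exact/asboolP.
Qed.

Lemma homology_piP (z w : tot_cycle C k.+2) :
  homology_pi z = homology_pi w <-> @res_bound X 0 k.+2 (val z - val w).
Proof.
split=> [/eqP|[y [yk _ dy]]]; rewrite -?Quotient.idealrBE.
  by move=> /asboolP[y yk dy]; exists y; split=> //; rewrite dy raddfB.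
by apply/eqP; rewrite -Quotient.idealrBE; apply/asboolP; exists y; rewrite // dy raddfB.
Qed.

Lemma hopf_num_val (x : N) : hopf_num (all_faces X k) (val x).
Proof. exact/asboolP/(valP x). Qed.

Lemma hopf_homology_iso : exists f : xmod_hopf X k -> xmod_homology X k.+2,
  bijective f /\ {morph f : x y / (x * y)%g >-> x + y}.
Proof.
have [R RP] := res_corr X k.+1 0.
have val_cycle (z : tot_cycle C k.+2) : @res_cycle X 0 k.+2 (val z).
  by have /asboolP[zk dz] := valP z; split.
pose Rel (x : N) (z : tot_cycle C k.+2) := R (val z) (beta (val x)).
have Rel_total x : exists z, Rel x z.
  have [z [zk _ dz _] Rz] := zcorr_surj RP (res_cycle_beta (hopf_num_val x)).
  have zP : tot_cycle_pred (C := C) k.+2 z by exact/asboolP.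
  by exists (Sub z zP); rewrite /Rel SubK.
(* Read from right to left this makes [f] well defined, from left to right injective. *)
have Rel_bound x y z w : Rel x z -> Rel y w ->
    (homology_pi z = homology_pi w <-> hopf_pi x = hopf_pi y).
  move=> xz yw; rewrite homology_piP hopf_piP.
  have xk : killedG (all_faces X k) (val x) by move=> i; exact: (hopf_num_val x).2.
  have yk : killedG (all_faces X k) (val y) by move=> i; exact: (hopf_num_val y).2.
  have xyk : killedG (all_faces X k) ((val x)^-1 * val y)%g.
    by move=> i; rewrite gmulfM gmulfV xk yk invg1 mulg1.
  have zw_cycle : @res_cycle X 0 k.+2 (val z - val w).
    by have := val_cycle (z - w); rewrite raddfB.
  have -> := zcorr_bound RP zw_cycle (zcorrB RP xz yw).
  have Bxy := res_bound_betaM ((val x)^-1 * val y)%g xk; rewrite mulVKg in Bxy.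
  split=> [B|/hopf_den_beta B].
    apply: beta_hopf_den => //; have := res_boundB Bxy B.
    by rewrite [beta (val x) + _]addrC -[_ + _ - beta (val y)]addrA addrK.
  by have := res_boundB Bxy B; rewrite addrAC addrK.
have Rel_mul x y z w v : Rel x z -> Rel y w -> Rel (x * y)%g v ->
    homology_pi v = homology_pi z + homology_pi w.
  move=> xz yw xyv.
  have Bxy := res_bound_betaM (val y) (fun i => (hopf_num_val x).2 i I).
  have v_cycle : @res_cycle X 0 k.+2 (val v - val z - val w).
    by have := val_cycle (v - z - w); rewrite !raddfB.
  rewrite -[RHS](raddfD (\pi_(Quotient.quot (@tot_boundary C k.+2)))).
  apply/homology_piP; rewrite raddfD /= addrA.
  apply/(zcorr_bound RP v_cycle (zcorrB RP (zcorrB RP xyv xz) yw)).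
  (* The negative of [Bxy], written with differences only. *)
  have := res_boundB (res_boundB Bxy Bxy) Bxy.
  by rewrite subrr sub0r opprB opprD addrA gmulfM.
have [g gP] := choice Rel_total.
pose f (q : xmod_hopf X k) := homology_pi (g (repr q)); exists f.
have fE x z : Rel x z -> f (hopf_pi x) = homology_pi z.
  by move=> xz; apply/(Rel_bound _ _ _ _ (gP _) xz); rewrite reprK.
split; last first.
  move=> p q; have [v xyv] := Rel_total (repr p * repr q)%g.
  rewrite -(Rel_mul _ _ _ _ _ (gP _) (gP _) xyv) -(fE _ _ xyv).
  have -> : hopf_pi (repr p * repr q)%g = (hopf_pi (repr p) * hopf_pi (repr q))%g.
    exact: quotg_piM.
  by rewrite !reprK.
have f_inj : injective f.
  by move=> p q /(Rel_bound _ _ _ _ (gP _) (gP _)); rewrite !reprK.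
have f_surj h : exists q, f q = h.
  elim/quotW: h => z; have [b zb] := zcorr_total RP (val_cycle z).
  have [x xN bx] := res_cycle_beta_surj (zcorr_cycle RP (val_cycle z) zb).
  have xP : `[< hopf_num (all_faces X k) x >] by exact/asboolP.
  pose x' : N := Sub x xP; have [w xw] := Rel_total x'.
  exists (hopf_pi x'); rewrite (fE _ _ xw); symmetry; apply/homology_piP.
  have zw_cycle : @res_cycle X 0 k.+2 (val z - val w).
    by have := val_cycle (z - w); rewrite raddfB.
  apply/(zcorr_bound RP zw_cycle (zcorrB RP zb xw)).
  by rewrite SubK.
have [f' f'P] := choice f_surj.
by exists f' => [q|//]; apply: f_inj.
Qed.
End HopfToHomology.

Theorem theorem6p1 (X : xmod) (n : nat) (n_gt0 : (0 < n)%N) :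
  exists f : xmod_hopf X n.-1 -> xmod_homology X n.+1,
    bijective f /\ {morph f : x y / (x * y)%g >-> (x + y)%R}.
Proof. by case: n n_gt0 => [//|k] _; exact: hopf_homology_iso. Qed.
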